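(* Let $A_1, A_2$ be nonempty $C$-coconvex sets. If $0<p<1$, then $$V_n(A_1\oplus_p A_2)^{\frac pn}\le V_n(A_1)^{\frac pn}+V_n(A_2)^{\frac pn},$$ with equality if and only if $A_1=\alpha A_2$ for some $\alpha>0$.
   Context: $C\subset\mathbb{R}^n$ is a fixed pointed closed convex cone with vertex at the origin $o$ and nonempty interior (closed, convex, $\lambda x\in C$ for $x\in C$, $\lambda\ge 0$, and $C\cap(-C)=\{o\}$). Its polar cone is $C^\circ=\{x\in\mathbb{R}^n: x\cdot y\le 0\ \text{for all } y\in C\}$, and $\Omega_C=S^{n-1}\cap\mathrm{int}\,C^\circ$. $V_n$ is volume (Lebesgue measure). For $u\in S^{n-1}$, $t\in\mathbb{R}$, $H^-(u,t)=\{x\in\mathbb{R}^n: x\cdot u\le t\}$. A set $A\subset C$ is $C$-coconvex if $V_n(A)<\infty$ and $A^\bullet=C\setminus A$ is closed and convex. The support function of a $C$-coconvex set $A$ is $\overline h(A,x)=-\sup\{x\cdot y: y\in A^\bullet\}$ for $x\in\mathrm{int}\,C^\circ$; it is positive and finite when $A\ne\emptyset$. For $\alpha>0$, $\alpha A=\{\alpha x:x\in A\}$. For $0<p<1$, the $p$-co-sum of nonempty $C$-coconvex sets $A_1,A_2$ is $$A_1\oplus_p A_2=C\setminus\Big(C\cap\bigcap_{u\in\Omega_C}H^-\big(u,-(\overline h(A_1,u)^p+\overline h(A_2,u)^p)^{1/p}\big)\Big).$$ *)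

(* Defs.v *)
From HB Require Import structures.
From mathcomp Require Import all_boot all_order all_algebra.
From mathcomp Require Import all_classical all_reals all_analysis.

Set Implicit Arguments.
Unset Strict Implicit.
Unset Printing Implicit Defensive.

Import Order.TTheory GRing.Theory Num.Theory.
Import numFieldNormedType.Exports.

Local Open Scope classical_set_scope.
Local Open Scope ring_scope.

(* n-dimensional Lebesgue measure as the n-fold product of the one-dimensional
   one. It is built on n.-tuples, which carry the product sigma-algebra; mu
   below is the measure in dimension n, and pushing lebesgue_measure \x mu
   forward along (t, x) |-> t :: x yields the one in dimension n.+1. *)
Section lebesgue_tuple_step.
Context {R : realType} (n : nat).
Local Notation mR := (measurableTypeR R).
Variable mu : {sigma_finite_measure set (n.-tuple mR) -> \bar R}.

Definition tuple_cons (z : mR * n.-tuple mR) : n.+1.-tuple mR :=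
  [tuple of z.1 :: z.2].

Lemma measurable_tuple_cons : measurable_fun setT tuple_cons.
Proof. exact: measurable_cons. Qed.

Definition lebesgue_tupleS : set (n.+1.-tuple mR) -> \bar R :=
  pushforward (@lebesgue_measure R \x mu)%E tuple_cons.

Let lebesgue_tupleS0 : lebesgue_tupleS set0 = 0%E.
Proof. by rewrite /lebesgue_tupleS /pushforward preimage_set0 measure0. Qed.

Let lebesgue_tupleS_ge0 A : (0 <= lebesgue_tupleS A)%E.
Proof. by apply: integral_ge0 => x _ /=; exact: measure_ge0. Qed.

Let lebesgue_tupleS_sigma_additive : semi_sigma_additive lebesgue_tupleS.
Proof.
move=> F mF tF mUF; rewrite /lebesgue_tupleS /pushforward preimage_bigcup.
apply: measure_semi_sigma_additive.
- by move=> i; rewrite -[X in measurable X]setTI; exact: measurable_tuple_cons.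
- apply/trivIsetP => /= i j _ _ ij; rewrite -preimage_setI.
  by move/trivIsetP : tF => /(_ _ _ _ _ ij) ->//; rewrite preimage_set0.
- rewrite -preimage_bigcup -[X in measurable X]setTI.
  exact: measurable_tuple_cons.
Qed.

HB.instance Definition _ := isMeasure.Build _ _ _ lebesgue_tupleS
  lebesgue_tupleS0 lebesgue_tupleS_ge0 lebesgue_tupleS_sigma_additive.

Lemma lebesgue_tupleS_sigma_finite : sigma_finite setT lebesgue_tupleS.
Proof.
have /sigma_finiteP[F [FT ndF Foo]] := sigma_finiteT (@lebesgue_measure R).
have /sigma_finiteP[G [GT ndG Goo]] := sigma_finiteT mu.
pose uncons (t : n.+1.-tuple mR) : mR * n.-tuple mR :=
  (tnth t ord0, [tuple of behead t]).
have unconsK : uncons \o tuple_cons = id.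
  by apply/funext => -[a b]; congr (_, _); exact/val_inj.
have muncons : measurable_fun setT uncons.
  by apply/measurable_fun_pair; [exact: measurable_tnth|exact: measurable_behead].
exists (fun k => uncons @^-1` (F k `*` G k)).
  apply/seteqP; split => // t _.
  have [k _ Fk] : (\bigcup_k F k) (uncons t).1 by rewrite -FT.
  have [l _ Gl] : (\bigcup_k G k) (uncons t).2 by rewrite -GT.
  exists (maxn k l) => //; split.
  - by move: Fk; exact/subsetPset/ndF/leq_maxl.
  - by move: Gl; exact/subsetPset/ndG/leq_maxr.
move=> k; have [mFk Fkoo] := Foo k; have [mGk Gkoo] := Goo k; split.
  by rewrite -[X in measurable X]setTI; apply: muncons => //; exact: measurableX.
rewrite /lebesgue_tupleS /pushforward -comp_preimage unconsK preimage_id.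
by rewrite product_measure1E// lte_mul_pinfty// ge0_fin_numE.
Qed.

HB.instance Definition _ := Measure_isSigmaFinite.Build _ _ _ lebesgue_tupleS
  lebesgue_tupleS_sigma_finite.

End lebesgue_tuple_step.

Fixpoint lebesgue_tuple (R : realType) (n : nat) :
    {sigma_finite_measure set (n.-tuple (measurableTypeR R)) -> \bar R} :=
  match n with
  | 0%N => dirac [tuple]
  | m.+1 => lebesgue_tupleS (lebesgue_tuple R m)
  end.

Section coconvex.
Context {R : realType} {n : nat}.
Implicit Types (A C : set 'rV[R]_n) (x y u : 'rV[R]_n).

Definition volume A : \bar R :=
  lebesgue_tuple R n [set t | A (\row_i tnth t i)].

Definition dotmul x y : R := \sum_(i < n) x ord0 i * y ord0 i.

(* `|x| on 'rV[R]_n is the max norm, hence this explicit Euclidean norm. *)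
Definition enorm x : R := Num.sqrt (dotmul x x).

Definition unit_sphere : set 'rV[R]_n := [set u | enorm u = 1].

Definition pointed_closed_convex_cone C : Prop :=
  [/\ closed C, convex_set C,
      forall (l : R) x, 0 <= l -> C x -> C (l *: x) &
      C `&` [set - x | x in C] = [set 0]].

Definition polar C : set 'rV[R]_n :=
  [set x | forall y, C y -> dotmul x y <= 0].

Definition Omega C : set 'rV[R]_n := unit_sphere `&` interior (polar C).

Definition lower_halfspace u (t : R) : set 'rV[R]_n :=
  [set x | dotmul x u <= t].

Definition coconvex C A : Prop :=
  [/\ A `<=` C, (volume A < +oo)%E, closed (C `\` A) & convex_set (C `\` A)].

(* Meaningful for x in the interior of polar C; there the set is nonempty and
   bounded above as soon as 0 < n, so that the real-valued sup is the actual
   supremum. *)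
Definition cosupport C A x : R := - sup [set dotmul x y | y in C `\` A].

Definition cosum C (p : R) A1 A2 : set 'rV[R]_n :=
  C `\` (C `&` \bigcap_(u in Omega C)
    lower_halfspace u
      (- (cosupport C A1 u `^ p + cosupport C A2 u `^ p) `^ p^-1)).

Definition dilate (a : R) A : set 'rV[R]_n := [set a *: x | x in A].

End coconvex.

(* Main.v *)
(* For X = C \ A with A coconvex, let r_X(x) be the least t > 0 with t x in X.
   The finiteness of the volume of A forces X + C to be contained in X, so that,
   up to a null cone, A = {r_X > 1}. If x is such that r_1(x)^p + r_2(x)^p <= 1,
   then evaluating at u in Omega_C gives h_i(u) <= r_i(x) |x.u| and hence
   x.u <= -(h_1(u)^p + h_2(u)^p)^(1/p): the p-co-sum is contained in
   {r_1^p + r_2^p > 1}. In polar coordinates V(A)^(p/n) is, up to a constant, the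
   L^(n/p) norm of r^p over directions, so Minkowski's inequality with exponent
   n/p > 1 gives the inequality. Equality makes r_1 and r_2 proportional almost
   everywhere, hence everywhere. Conversely, if A_1 = a A_2 then the p-co-sum
   contains (a^p + 1)^(1/p) A_2, because points outside a closed convex X are
   separated from it by directions of Omega_C. *)

Require Import Defs.
From HB Require Import structures.
From mathcomp Require Import all_boot all_order all_algebra.
From mathcomp Require Import all_classical all_reals all_analysis.
From mathcomp Require Import measurable_realfun ring lra.

Set Implicit Arguments.
Unset Strict Implicit.
Unset Printing Implicit Defensive.

Import Order.TTheory GRing.Theory Num.Theory.
Import numFieldNormedType.Exports.

Local Open Scope classical_set_scope.
Local Open Scope ring_scope.

(** * Lebesgue measure on row vectors *)

(** Directions are integrated over the unit ball of the max norm instead of a sphere: |x|^p r(x)^p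
    is constant along rays, so its (n/p)-th power integrates over that ball to V(A). Since p < 1,
    the exponent n/p exceeds 1 even when n = 1; t^(n/p) is then strictly convex, and Minkowski's
    inequality is proved with its equality case from a pointwise strict inequality. The radial
    function of the p-co-sum itself is never computed: a set containing it bounds its volume from
    above, and in the equality case a dilate contained in it bounds the volume from below. Rays of C
    that miss X carry the value r = 0 although they lie in A, so each passage between sets and
    radial functions has to discard a null cone. The last passage, from almost everywhere to
    everywhere, rests on X + C being contained in X: near any point of X, and inside X, there are
    balls of positive volume. *)

Section row_measurable.
Context {R : realType} {n : nat}.
Local Notation mR := (measurableTypeR R).

Definition row_of_tuple (t : n.-tuple mR) : 'rV[R]_n := \row_i tnth t i.

(* The sigma-algebra on row vectors for which [volume] is a measure. *)
Definition row_measurable : set (set 'rV[R]_n) :=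
  [set A | measurable (row_of_tuple @^-1` A)].

Let row_measurable0 : row_measurable set0.
Proof. by rewrite /row_measurable/= preimage_set0. Qed.

Let row_measurableC A : row_measurable A -> row_measurable (~` A).
Proof. by rewrite /row_measurable/= preimage_setC; exact: measurableC. Qed.

Let row_measurable_bigcup (F : (set 'rV[R]_n)^nat) :
  (forall i, row_measurable (F i)) -> row_measurable (\bigcup_i F i).
Proof.
by move=> mF; rewrite /row_measurable/= preimage_bigcup; apply: bigcupT_measurable => i; exact: mF.
Qed.

HB.instance Definition _ := @isMeasurable.Build default_measure_display
  'rV[R]_n row_measurable row_measurable0 row_measurableC row_measurable_bigcup.

Lemma volumeE (A : set 'rV[R]_n) :
  volume A = lebesgue_tuple R n (row_of_tuple @^-1` A).
Proof. by []. Qed.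

Let volume0 : volume (set0 : set 'rV[R]_n) = 0%E.
Proof. by rewrite volumeE preimage_set0 measure0. Qed.

Let volume_ge0 (A : set 'rV[R]_n) : (0 <= volume A)%E.
Proof. by rewrite volumeE; exact: measure_ge0. Qed.

Let volume_sigma_additive : semi_sigma_additive (@volume R n).
Proof.
move=> F mF tF mUF; rewrite volumeE preimage_bigcup.
apply: measure_semi_sigma_additive => //.
apply/trivIsetP => /= i j _ _ ij; rewrite -preimage_setI.
by move/trivIsetP : tF => /(_ _ _ _ _ ij) ->//; rewrite preimage_set0.
Qed.

HB.instance Definition _ := isMeasure.Build _ _ _ (@volume R n)
  volume0 volume_ge0 volume_sigma_additive.

Lemma measurable_coord i : measurable_fun setT (fun x : 'rV[R]_n => x ord0 i).
Proof.
move=> _ Y mY; rewrite setTI; rewrite /measurable/= /row_measurable/=.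
rewrite -comp_preimage (_ : _ \o _ = (@tnth n mR ^~ i)); last first.
  by apply/funext => t /=; rewrite mxE.
by have := @measurable_tnth _ mR n i measurableT Y mY; rewrite setTI.
Qed.

Lemma measurable_box (P : 'I_n -> set R) : (forall i, measurable (P i)) ->
  measurable [set x : 'rV[R]_n | forall i, P i (x ord0 i)].
Proof.
move=> mP; rewrite (_ : [set _ | _] =
    \big[setI/setT]_(i < n) [set x : 'rV[R]_n | P i (x ord0 i)]).
  apply: bigsetI_measurable => i _.
  rewrite -[X in measurable X]setTI; exact: measurable_coord.
apply/seteqP; split => [x Px|x].
  by elim/big_ind: _ => //= i _; exact: Px.
by rewrite -bigcap_seq => Px i; apply: (Px i); rewrite /= mem_index_enum.
Qed.

Lemma ball_rowE (x : 'rV[R]_n) (r : R) : 0 < r ->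
  ball x r = [set y | forall i, ball (x ord0 i) r (y ord0 i)].
Proof.
move=> r0; apply/seteqP; split => [y [_ xy] i|y xy]; first exact: xy.
by split => // i j; rewrite ord1; exact: xy.
Qed.

Lemma measurable_ball_row (x : 'rV[R]_n) (r : R) : 0 < r ->
  measurable (ball x r).
Proof.
move=> r0; rewrite ball_rowE//; apply: (@measurable_box (fun i => ball (x ord0 i) r)).
by move=> i; exact: measurable_ball.
Qed.

(** The sigma-algebra is pulled back from tuples, so it is not Borel by construction. An open set is
    the union of the balls with rational centre and radius 1/(k+1) that it contains, and these are
    countably many. *)
Lemma open_measurable_row (A : set 'rV[R]_n) : open A -> measurable A.
Proof.
move=> oA.
pose F (qk : 'rV[rat]_n * nat) : set 'rV[R]_n :=
  let B := ball (map_mx ratr qk.1 : 'rV[R]_n) (qk.2.+1%:R^-1) in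
  if `[< B `<=` A >] then B else set0.
suff -> : A = \bigcup_qk F qk.
  apply: countable_bigcupT_measurable => // -[q k]; rewrite /F/=.
  by case: asboolP => // _; apply: measurable_ball_row; rewrite invr_gt0.
apply/seteqP; split=> [x Ax|x [qk _]]; last first.
  by rewrite /F; case: asboolP => // + Bx; exact.
have /nbhs_ballP[e /= e0 xeA] : nbhs x A by exact: open_nbhs_nbhs.
(* Half of [e], because a point of the small ball is reached from [x] through its rational centre,
   at a cost of two radii. *)
have [k /ltW ke] : exists k : nat, k.+1%:R^-1 < e / 2.
  exists (Num.truncn ((e / 2)^-1)); rewrite -[ltRHS]invrK.
  rewrite ltf_pV2 ?posrE ?invr_gt0 ?divr_gt0//.
  exact: truncnS_gt.
have k0 : 0 < k.+1%:R^-1 :> R by rewrite invr_gt0.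
have /choice[q qx] : forall i, exists q : rat, ball (x ord0 i) k.+1%:R^-1 (ratr q).
  move=> i; have /rat_in_itvoo[q] : x ord0 i - k.+1%:R^-1 < x ord0 i + k.+1%:R^-1.
    by rewrite ltrBlDr -addrA ltrDl addr_gt0.
  by rewrite in_itv/= => /andP[q1 q2]; exists q; rewrite ball_itv/= in_itv/= q1.
exists (\row_i q i, k) => //; rewrite /F/=.
have Bx : ball (map_mx ratr (\row_i q i) : 'rV[R]_n) k.+1%:R^-1 x.
  by rewrite ball_rowE// => i; rewrite !mxE; exact/ball_sym/qx.
case: asboolP => // -[] y By; apply: xeA.
apply: (@le_ball _ _ _ (k.+1%:R^-1 + k.+1%:R^-1)).
  by rewrite (splitr e) lerD.
by apply: ball_triangle By; exact: ball_sym.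
Qed.

Lemma closed_measurable_row (A : set 'rV[R]_n) : closed A -> measurable A.
Proof.
move=> cA; rewrite -[A]setCK; apply: measurableC; apply: open_measurable_row.
exact: closed_openC.
Qed.

End row_measurable.

(** * Volumes of cubes and behaviour under scaling *)

Lemma lebesgue_tuple_box (R : realType) (n : nat) (a : 'I_n -> R) (r : R) :
  0 <= r ->
  lebesgue_tuple R n [set t | forall i, ball (a i) r (tnth t i)] =
  ((r *+ 2) ^+ n)%:E.
Proof.
move=> r0; elim: n a => [|n IH] a.
  by rewrite /= diracE expr0 mem_set// => -[].
rewrite /= /lebesgue_tupleS /pushforward.
set B := [set t : n.-tuple (measurableTypeR R) |
  forall i, ball (a (lift ord0 i)) r (tnth t i)].
have mball (b : R) : measurable (ball b r).
  by rewrite ball_itv; exact: measurable_itv.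
have mB : measurable B.
  have -> : B = \big[setI/setT]_(i < n)
      ((@tnth n (measurableTypeR R) ^~ i) @^-1` ball (a (lift ord0 i)) r).
    apply/seteqP; split => [x Px|x].
      by elim/big_ind: _ => //= i _; exact: Px.
    by rewrite -bigcap_seq => Px i; apply: (Px i); rewrite /= mem_index_enum.
  apply: bigsetI_measurable => i _.
  by rewrite -[X in measurable X]setTI; apply: measurable_tnth => //; exact: mball.
set D := _ @^-1` _; have -> : D = ball (a ord0) r `*` B.
  apply/seteqP; split => [[s t] /= H|[s t] /= [H1 H2] i]; first split => /=.
  - by have := H ord0; rewrite (tnth_nth s).
  - by move=> i; have := H (lift ord0 i); rewrite tnthS.
  case: (unliftP ord0 i) => [j|] ->; first by rewrite tnthS; exact: H2.
  by rewrite (tnth_nth s).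
rewrite product_measure1E//; last exact: mball.
rewrite [X in (X * _)%E](_ : _ = (r *+ 2)%:E); last exact: lebesgue_measure_ball.
by rewrite [X in (_ * X)%E]IH -EFinM exprS.
Qed.

(** Hides the construction of the measure behind its formula, so that uniqueness theorems can be
    applied to it. *)
Lemma exists_scaled_pushforward d d' (T : measurableType d)
    (T' : measurableType d') (R : realType) (m : {measure set T -> \bar R})
    (f : T -> T') (r : R) : 0 <= r -> measurable_fun setT f ->
  exists nu : {measure set T' -> \bar R},
    forall X, nu X = (r%:E * m (f @^-1` X))%E.
Proof.
move=> r0 mf.
by exists (mscale (NngNum r0)
  (measure_function_pushforward__canonical__measure_function_Measure m mf)).
Qed.

(** The pushforward under multiplication by c, times c, agrees with Lebesgue measure on half-open
    intervals and hence everywhere. *)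
Lemma lebesgue_measure_scale (R : realType) (c : R) (A : set (measurableTypeR R)) :
  0 < c -> measurable A ->
  lebesgue_measure
    ((fun x : measurableTypeR R => c * x : measurableTypeR R) @^-1` A) =
  (c^-1%:E * lebesgue_measure A)%E.
Proof.
move=> c0 mA.
have mc : measurable_fun setT
    (fun x : measurableTypeR R => c * x : measurableTypeR R).
  exact: mulrl_measurable.
have [nu nuE] := exists_scaled_pushforward (@lebesgue_measure R) (ltW c0) mc.
have -> // : lebesgue_measure A = nu A.
  apply: lebesgue_measure_unique => // X [[a b] _ <-].
  rewrite nuE.
  have -> : *%R c @^-1` `]a, b] = `]c^-1 * a, c^-1 * b]%classic.
    apply/seteqP; split => x /=; rewrite !in_itv/=;
      by rewrite ltr_pdivrMl// ler_pdivlMl.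
  rewrite [LHS]lebesgue_measure_itv [X in (_ * X)%E]lebesgue_measure_itv/=.
  rewrite !lte_fin ltr_pM2l ?invr_gt0//.
  case: ifPn => _; last by rewrite mule0.
  by rewrite -!EFinB -EFinM -mulrBr mulrA divff ?mul1r// gt_eqF.
by rewrite nuE muleA -EFinM mulVf ?mul1e// gt_eqF.
Qed.

Section scale.
Context {R : realType}.
Local Notation mR := (measurableTypeR R).

Definition tuple_scale n (c : R) (t : n.-tuple mR) : n.-tuple mR :=
  [tuple (c * tnth t i : mR) | i < n].

Lemma measurable_tuple_scale n c : measurable_fun setT (@tuple_scale n c).
Proof.
apply/measurable_fun_tnthP => i.
rewrite (_ : _ \o _ = fun t => c * tnth t i : mR); last first.
  by apply/funext => t /=; rewrite tnth_mktuple.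
by apply: measurableT_comp; [exact: mulrl_measurable|exact: measurable_tnth].
Qed.

(** Induction on the dimension: c^(n+1) times the pushforward of the product measure agrees with the
    product measure on rectangles, one factor c being absorbed by the first coordinate and c^n by
    the others. *)
Lemma lebesgue_tuple_scale n (c : R) (A : set (n.-tuple mR)) :
  0 < c -> measurable A ->
  lebesgue_tuple R n (tuple_scale c @^-1` A) =
  ((c^-1 ^+ n)%:E * lebesgue_tuple R n A)%E.
Proof.
move=> c0; elim: n A => [|n IH] A mA.
  rewrite expr0 mul1e (_ : tuple_scale c @^-1` A = A)//.
  by apply/seteqP; split => t /=; rewrite (tuple0 t) (tuple0 (tuple_scale _ _)).
rewrite /= /lebesgue_tupleS /pushforward.
pose sc (z : mR * n.-tuple mR) : mR * n.-tuple mR := (c * z.1, tuple_scale c z.2).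
have msc : measurable_fun setT sc.
  apply/measurable_fun_pair.
    by apply: measurableT_comp => //; exact: mulrl_measurable.
  by apply: measurableT_comp => //; exact: measurable_tuple_scale.
have [nu nuE] := exists_scaled_pushforward
  (@lebesgue_measure R \x lebesgue_tuple R n)%E (ltW (exprn_gt0 n.+1 c0)) msc.
have scaleE (x y : \bar R) :
    ((c ^+ n.+1)%:E * (c^-1%:E * x * ((c^-1 ^+ n)%:E * y)) = x * y)%E.
  rewrite muleACA -EFinM -exprS !muleA -EFinM -exprMn divff ?gt_eqF//.
  by rewrite expr1n mul1e.
have mA' : measurable (@tuple_cons R n @^-1` A).
  by rewrite -[X in measurable X]setTI; exact: measurable_tuple_cons.
rewrite (@product_measure_unique _ _ _ _ _ _ _ nu _ (@tuple_cons R n @^-1` A))//; last first.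
  move=> X Y mX mY; rewrite nuE.
  rewrite (_ : _ @^-1` _ =
    ((fun x : mR => c * x : mR) @^-1` X) `*` (tuple_scale c @^-1` Y))//.
  have mcX : measurable ((fun x : mR => c * x : mR) @^-1` X).
    by rewrite -[X in measurable X]setTI; exact: mulrl_measurable.
  have mcY : measurable (tuple_scale c @^-1` Y).
    by rewrite -[X in measurable X]setTI; exact: measurable_tuple_scale.
  rewrite [X in (_ * X)%E](_ : _ =
    (lebesgue_measure ((fun x : mR => (c * x)%R : mR) @^-1` X) *
     lebesgue_tuple R n (tuple_scale c @^-1` Y))%E); last first.
    exact: product_measure1E.
  rewrite [X in (_ * (X * _))%E]lebesgue_measure_scale// [X in (_ * (_ * X))%E]IH//.
rewrite nuE muleA -EFinM -exprMn mulVf ?gt_eqF// expr1n mul1e.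
congr ((_ \x _)%E _).
have scE x t : tuple_scale c (tuple_cons (x, t)) = tuple_cons (sc (x, t)).
  apply: eq_from_tnth => i; rewrite tnth_mktuple.
  case: (unliftP ord0 i) => [j|] ->; first by rewrite !tnthS tnth_mktuple.
  by rewrite !(tnth_nth x).
by apply/seteqP; split => -[x t] /=; rewrite scE.
Qed.

End scale.

Section measurable_comparison.
Context d (T : measurableType d) (R : realType).

Lemma measurable_set_ltr (f g : T -> R) :
  measurable_fun setT f -> measurable_fun setT g ->
  measurable [set x | f x < g x].
Proof.
move=> mf mg; have := measurable_fun_ltr mf mg.
by move=> /(_ measurableT [set true]); rewrite setTI; exact.
Qed.

Lemma measurable_set_ler (f g : T -> R) :
  measurable_fun setT f -> measurable_fun setT g ->
  measurable [set x | f x <= g x].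
Proof.
move=> mf mg; rewrite (_ : mkset _ = ~` [set x | g x < f x]).
  by apply: measurableC; exact: measurable_set_ltr.
by apply/seteqP; split => x /=; rewrite leNgt => /negP.
Qed.

Lemma measurable_set_neqr (f g : T -> R) :
  measurable_fun setT f -> measurable_fun setT g ->
  measurable [set x | f x != g x].
Proof.
move=> mf mg.
rewrite (_ : mkset _ = [set x | f x < g x] `|` [set x | g x < f x]).
  by apply: measurableU; exact: measurable_set_ltr.
apply/seteqP; split => x /=; first by rewrite neq_lt => /orP.
by move=> /orP; rewrite -neq_lt.
Qed.

End measurable_comparison.

Section volume_row.
Context {R : realType} {n : nat}.
Implicit Types (A : set 'rV[R]_n) (x : 'rV[R]_n).

Lemma measurable_preimage_scale (c : R) A : measurable A ->
  measurable ((fun x => c *: x) @^-1` A).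
Proof.
move=> mA; rewrite /measurable/= /row_measurable/=.
rewrite (_ : _ @^-1` _ = tuple_scale c @^-1` (row_of_tuple @^-1` A)).
  rewrite -[X in measurable X]setTI; apply: measurable_tuple_scale => //.
by apply/seteqP; split => t /=;
  rewrite (_ : c *: _ = row_of_tuple (tuple_scale c t))//;
  apply/rowP => i; rewrite !mxE tnth_mktuple.
Qed.

Lemma volume_scale (c : R) A : 0 < c -> measurable A ->
  volume ((fun x => c *: x) @^-1` A) = ((c^-1 ^+ n)%:E * volume A)%E.
Proof.
move=> c0 mA; rewrite !volumeE -lebesgue_tuple_scale//.
congr (lebesgue_tuple R n _).
by apply/seteqP; split => t /=;
  rewrite (_ : c *: _ = row_of_tuple (tuple_scale c t))//;
  apply/rowP => i; rewrite !mxE tnth_mktuple.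
Qed.

Lemma volume_ball x (r : R) : 0 < r -> volume (ball x r) = ((r *+ 2) ^+ n)%:E.
Proof.
move=> r0; rewrite ball_rowE// volumeE -(lebesgue_tuple_box (x ord0) (ltW r0)).
by congr (lebesgue_tuple R n _); apply/seteqP; split => t /= H i;
  have := H i; rewrite mxE.
Qed.

Lemma continuous_measurable_row (f : 'rV[R]_n -> R) : continuous f ->
  measurable_fun setT f.
Proof.
move=> cf; apply: (measurability _ (RGenOpens.measurableE R)).
move=> _ [_ [a [b ->] <-]]; rewrite setTI; apply: open_measurable_row.
move/continuousP : cf; apply; exact: interval_open.
Qed.

Lemma measurable_norm_row : measurable_fun setT (fun x : 'rV[R]_n => `|x|).
Proof. by apply: continuous_measurable_row; exact: norm_continuous. Qed.

Lemma unit_ballE : ball (0 : 'rV[R]_n) 1 = [set x | `|x| < 1].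
Proof.
by rewrite mx_norm_ball; apply/seteqP; split => x; rewrite /ball_/= sub0r normrN.
Qed.

End volume_row.

(** * Polar coordinates by slicing into layers *)

(** Summing over j gives U <= V + W/(k+1) for every mesh 1/(k+1), and W is finite. [volume_polar]
    uses it twice, with U and V exchanged. *)
Lemma series_layer_le (R : realType) (U V W : \bar R)
    (u v w : nat -> nat -> \bar R) :
  W \is a fin_num ->
  (forall k j, 0 <= u k j)%E -> (forall k j, 0 <= v k j)%E ->
  (forall k j, 0 <= w k j)%E ->
  (forall k, U = \sum_(j <oo) u k j)%E -> (forall k, V = \sum_(j <oo) v k j)%E ->
  (forall k, W = \sum_(j <oo) w k j)%E ->
  (forall k j, u k j <= (j.+1%:R / k.+1%:R)%:E * w k j)%E ->
  (forall k j, (j%:R / k.+1%:R)%:E * w k j <= v k j)%E ->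
  (U <= V)%E.
Proof.
move=> Wfin u0 v0 w0 UE VE WE uw wv.
have UV k : (U <= V + k.+1%:R^-1%:E * W)%E.
  rewrite (UE k) (VE k) (WE k) -nneseriesZl// -nneseriesD//; last first.
    by move=> j _ _; rewrite mule_ge0// lee_fin invr_ge0.
  apply: lee_nneseries => // j _; apply: (le_trans (uw k j)).
  rewrite -natr1 mulrDl mul1r EFinD ge0_muleDl ?lee_fin ?divr_ge0 ?invr_ge0//.
  by rewrite leeD2r.
have W0 : (0 <= W)%E by rewrite (WE 0); apply: nneseries_ge0.
apply/lee_addgt0Pr => e e0.
have [k ke] : exists k : nat, fine W / e < k.+1%:R.
  by exists (Num.truncn (fine W / e)); exact: truncnS_gt.
apply: (le_trans (UV k)); rewrite leeD2l//.
rewrite -(fineK Wfin) -EFinM lee_fin ler_pdivrMl//.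
by rewrite -ler_pdivrMr// ltW.
Qed.

Section polar.
Context {R : realType} {n : nat}.
Hypothesis n0 : (0 < n)%N.
Implicit Types (D : set 'rV[R]_n) (x : 'rV[R]_n).

Definition homog0 D := forall (c : R) x, 0 < c -> D (c *: x) <-> D x.

Lemma volume_shell D (s : R) : measurable D -> homog0 D -> 0 <= s ->
  volume ([set x | `|x| ^+ n < s] `&` D) =
  (s%:E * volume ([set x | (`|x| < 1)%R] `&` D))%E.
Proof.
move=> mD hD; rewrite le_eqVlt => /predU1P[<-|s0].
  rewrite mul0e (_ : _ `&` _ = set0) ?measure0//.
  by apply/seteqP; split => // x [/= + _]; rewrite ltNge exprn_ge0.
(* Scaling by c = s^(-1/n) turns |x|^n < s into |x| < 1 and changes volume by c^(-n) = s. *)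
pose c : R := s `^ (- n%:R^-1).
have c0 : 0 < c by exact: powR_gt0.
have csE : c^-1 ^+ n = s.
  rewrite /c powRN invrK -powR_mulrn ?powR_ge0// -powRrM mulVf ?pnatr_eq0 -?lt0n//.
  by rewrite powRr1// ltW.
have mQ : measurable ([set x : 'rV[R]_n | `|x| < 1] `&` D).
  by apply: measurableI => //; apply: measurable_set_ltr => //; exact: measurable_norm_row.
rewrite -[in RHS]csE -volume_scale//; congr volume.
have cx x : (`|c *: x| < 1) = (`|x| ^+ n < s).
  by rewrite normrZ gtr0_norm// -ltr_pdivlMl// mulr1 -csE ltr_pXn2r// nnegrE// invr_ge0 ltW.
apply/seteqP; split => x /= [].
  by move=> xs Dx; split; [rewrite cx|apply/hD].
by rewrite cx => xs /hD Dx; split => //; exact: Dx.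
Qed.

(* Polar coordinates without a surface measure: |x|^n and a 0-homogeneous G are
   independent under the volume, |x|^n being uniform on [0, oo). *)
Lemma volume_polar (G : 'rV[R]_n -> R) :
  measurable_fun setT G -> (forall x, 0 <= G x) ->
  (forall c x, 0 < c -> G (c *: x) = G x) ->
  volume [set x | `|x| ^+ n < G x] =
  (\int[@volume R n]_(x in [set x | (`|x| < 1)%R]) (G x)%:E)%E.
Proof.
move=> mG G0 hG.
pose Q : set 'rV[R]_n := [set x | `|x| < 1].
(* On this layer [K] lies between the sets |x|^n < j/(k+1) and |x|^n < (j+1)/(k+1), whose volumes
   are given by [volume_shell]. *)
pose S (k j : nat) : set 'rV[R]_n :=
  [set x | j%:R / k.+1%:R <= G x] `&` [set x | G x < j.+1%:R / k.+1%:R].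
pose K : set 'rV[R]_n := [set x | `|x| ^+ n < G x].
have mN : measurable_fun setT (fun x : 'rV[R]_n => `|x|) by exact: measurable_norm_row.
have mK : measurable K by apply: measurable_set_ltr => //; exact: measurable_funX.
have mQ : measurable Q by exact: measurable_set_ltr.
have mS k j : measurable (S k j).
  by apply: measurableI; [exact: measurable_set_ler|exact: measurable_set_ltr].
have hS k j : homog0 (S k j) by move=> c x c0; rewrite /S/= hG.
have tS k : trivIset setT (S k).
  apply/trivIsetP => i j _ _ ij; apply/seteqP; split => // x [[/= a1 b1] [a2 b2]].
  move: ij; rewrite neq_ltn => /orP[|] ij.
    have := le_lt_trans a2 b1; rewrite ltr_pM2r ?invr_gt0// ltr_nat.
    by rewrite ltnS leqNgt ij.
  have := le_lt_trans a1 b2; rewrite ltr_pM2r ?invr_gt0// ltr_nat.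
  by rewrite ltnS leqNgt ij.
have US k : \bigcup_j S k j = setT.
  apply/seteqP; split => // x _.
  exists (Num.truncn (G x * k.+1%:R)) => //; split => /=.
    by rewrite ler_pdivrMr// truncn_le mulr_ge0.
  by rewrite ltr_pdivlMr// truncnS_gt.
have vE (D : set 'rV[R]_n) k : measurable D ->
    (volume D = \sum_(j <oo) volume (D `&` S k j))%E.
  move=> mD; rewrite -[in LHS](setIT D) -(US k) setI_bigcupr measure_bigcup//.
  - by apply: eq_eseriesl => i; rewrite in_setT.
  - by move=> i _; exact: measurableI.
  - by apply/trivIset_setIl/tS.
have iE k : (\int[@volume R n]_(x in Q) (G x)%:E =
    \sum_(j <oo) \int[@volume R n]_(x in Q `&` S k j) (G x)%:E)%E.
  rewrite -[in LHS](setIT Q) -(US k) setI_bigcupr ge0_integral_bigcup//.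
  - by move=> i; exact: measurableI.
  - by apply/measurable_EFinP; apply: measurable_funTS.
  - by move=> x _; rewrite lee_fin.
  - by apply/trivIset_setIl/tS.
have Qfin : volume Q \is a fin_num.
  by rewrite /Q -unit_ballE volume_ball.
have i0 k j : (0 <= \int[@volume R n]_(x in Q `&` S k j) (G x)%:E)%E.
  by apply: integral_ge0 => x _; rewrite lee_fin.
have mGQ k j : measurable_fun (Q `&` S k j) (EFin \o G).
  by apply/measurable_EFinP; apply: measurable_funTS.
have bd k j : 0 <= j%:R / k.+1%:R :> R by rewrite divr_ge0.
apply/eqP; rewrite eq_le; apply/andP; split.
  apply: (@series_layer_le _ _ _ (volume Q) (fun k j => volume (K `&` S k j))
    (fun k j => \int[@volume R n]_(x in Q `&` S k j) (G x)%:E)%E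
    (fun k j => volume (Q `&` S k j))) => //.
  - by move=> k; exact: vE.
  - by move=> k; exact: vE.
  - move=> k j; rewrite -volume_shell//; apply: le_measure; rewrite ?inE.
    + exact: measurableI.
    + by apply: measurableI => //; apply: measurable_set_ltr => //; exact: measurable_funX.
    + by move=> x [/= Kx [Sx1 Sx2]]; split => //=; exact: lt_trans Sx2.
  - move=> k j; rewrite -integral_cst; last exact: measurableI.
    apply: ge0_le_integral => //; first exact: measurableI.
    + by move=> x _; rewrite lee_fin.
    + by move=> x [_ [Sx1 _]]; rewrite lee_fin.
apply: (@series_layer_le _ _ _ (volume Q)
    (fun k j => \int[@volume R n]_(x in Q `&` S k j) (G x)%:E)%E
    (fun k j => volume (K `&` S k j))
    (fun k j => volume (Q `&` S k j))) => //.
- by move=> k; exact: vE.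
- by move=> k; exact: vE.
- move=> k j; rewrite -integral_cst; last exact: measurableI.
  apply: ge0_le_integral => //; first exact: measurableI.
  + by move=> x _; rewrite lee_fin.
  + by move=> x [_ [_ Sx1]]; rewrite lee_fin ltW.
- move=> k j; rewrite -volume_shell//; apply: le_measure; rewrite ?inE.
  + by apply: measurableI => //; apply: measurable_set_ltr => //; exact: measurable_funX.
  + exact: measurableI.
  + by move=> x [/= Kx [Sx1 Sx2]]; split => //=; exact: lt_le_trans Sx1.
Qed.

End polar.

(** * Minkowski's inequality and its equality case *)

Section strict_convexity.
Context {R : realType}.
Implicit Types (x y a b f g l m : R).

Lemma ltr_ln_subr1 x : 0 < x -> x != 1 -> ln x < x - 1.
Proof.
move=> x0 x1; have := @expR_gt1Dx R (ln x); rewrite ln_eq0// => /(_ x1).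
by rewrite lnK ?posrE// ltrBrDl.
Qed.

(** For L = 1 + m(x - 1) > 0, the bound on ln at L/x and at 1/x gives ln L - ln x < L/x - 1 = (m -
    1)(1 - 1/x) < (m - 1) ln x. *)
Lemma powR_gt_bernoulli x m : 0 <= x -> x != 1 -> 1 < m ->
  1 + m * (x - 1) < x `^ m.
Proof.
rewrite le_eqVlt => /predU1P[<- _ m1|x0 x1 m1].
  by rewrite powR0; [lra|rewrite gt_eqF//; lra].
have m0 : 0 < m by lra.
set L := 1 + m * (x - 1).
have [L0|L0] := leP L 0; first exact: le_lt_trans L0 (powR_gt0 _ _).
rewrite -ltr_ln ?posrE ?powR_gt0// ln_powR.
have Lx1 : L / x != 1.
  apply: contra_neq x1 => /(congr1 ( *%R^~ x)); rewrite mul1r divfK ?gt_eqF//.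
  rewrite /L => Lx; have : (m - 1) * (x - 1) = 0 by lra.
  by move/eqP; rewrite mulf_eq0 => /orP[]/eqP; lra.
have x'1 : x^-1 != 1 by rewrite invr_eq1.
have := ltr_ln_subr1 (divr_gt0 L0 x0) Lx1.
have x'0 : 0 < x^-1 by rewrite invr_gt0.
have := ltr_ln_subr1 x'0 x'1.
rewrite ln_div ?posrE// lnV ?posrE// => h1 h2.
have xx : x * x^-1 = 1 by rewrite divff// gt_eqF.
have h3 : (m - 1) * (- ln x) < (m - 1) * (x^-1 - 1) by rewrite ltr_pM2l// subr_gt0.
have h4 : L / x + (m - 1) * x^-1 = m.
  transitivity (m * (x * x^-1)); last by rewrite xx mulr1.
  by rewrite /L; ring.
by lra.
Qed.

(** Bernoulli's inequality places t^m strictly above its tangent at the mean z, both at x and at y;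
    the tangent values average to z^m. *)
Lemma powR_convex_strict l x y m : 0 < l < 1 -> 0 <= x -> 0 <= y -> x != y ->
  1 < m -> ((1 - l) * x + l * y) `^ m < (1 - l) * x `^ m + l * y `^ m.
Proof.
move=> /andP[l0 l1] x0 y0 xy m1.
set z := (1 - l) * x + l * y.
have l1' : 0 < 1 - l by lra.
have z0 : 0 < z.
  have [x00|x00] := eqVneq x 0.
    rewrite /z x00 mulr0 add0r mulr_gt0// lt_neqAle y0 andbT -x00//.
  rewrite /z ltr_pwDl// ?mulr_gt0 ?mulr_ge0//.
    by rewrite lt_neqAle x0 andbT eq_sym.
  exact: ltW.
have bern t : 0 <= t -> t != z -> z `^ m * (1 + m * (t / z - 1)) < t `^ m.
  move=> t0 tz; rewrite -[in ltRHS](divfK (lt0r_neq0 z0) t) powRM ?divr_ge0 ?(ltW z0)//.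
  rewrite mulrC ltr_pM2r ?powR_gt0//; apply: powR_gt_bernoulli => //.
    by rewrite divr_ge0// ltW.
  by apply: contra_neq tz => /(congr1 ( *%R^~ z)); rewrite mul1r divfK ?gt_eqF.
have xz : x != z.
  apply: contra_neq xy => xz; have : l * (y - x) = 0 by move: xz; rewrite /z; lra.
  by move/eqP; rewrite mulf_eq0 (gt_eqF l0)/= subr_eq0 => /eqP.
have yz : y != z.
  apply: contra_neq xy => yz; have : (1 - l) * (y - x) = 0 by move: yz; rewrite /z; lra.
  by move/eqP; rewrite mulf_eq0 (gt_eqF l1')/= subr_eq0 => /eqP.
have hx : (1 - l) * (z `^ m * (1 + m * (x / z - 1))) < (1 - l) * x `^ m.
  by rewrite ltr_pM2l//; exact: bern.
have hy : l * (z `^ m * (1 + m * (y / z - 1))) < l * y `^ m.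
  by rewrite ltr_pM2l//; exact: bern.
apply: (le_lt_trans _ (ltrD hx hy)).
rewrite le_eqVlt; apply/orP; left; apply/eqP.
have zz : ((1 - l) * x + l * y) / z = 1 by rewrite -/z divff// gt_eqF.
transitivity (z `^ m * (1 + m * (((1 - l) * x + l * y) / z - 1))); last by ring.
by rewrite zz subrr mulr0 addr0 mulr1.
Qed.

(* Convexity of [t `^ m] at [f / a] and [g / b], with weights [a / (a + b)] and
   [b / (a + b)]; when a and b are the L^m norms of f and g, integrating it
   gives Minkowski's inequality. *)
Lemma powRD_split f g a b m : 0 <= f -> 0 <= g -> 0 < a -> 0 < b -> 1 < m ->
  (f + g) `^ m <= (a + b) `^ m / (a + b) * (a * (f / a) `^ m + b * (g / b) `^ m)
    ?= iff (f * b == g * a).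
Proof.
move=> f0 g0 a0 b0 m1; set l := b / (a + b).
have ab0 : 0 < a + b by rewrite addr_gt0.
have l01 : 0 < l < 1 by rewrite divr_gt0//= ltr_pdivrMr// mul1r ltrDr.
have l1 : 1 - l = a / (a + b) by rewrite /l; field; rewrite gt_eqF.
have fgE : f + g = (a + b) * ((1 - l) * (f / a) + l * (g / b)).
  by rewrite l1 /l; field; rewrite !gt_eqF.
have RE : (a + b) `^ m / (a + b) * (a * (f / a) `^ m + b * (g / b) `^ m) =
    (a + b) `^ m * ((1 - l) * (f / a) `^ m + l * (g / b) `^ m).
  by rewrite l1 /l; field; rewrite gt_eqF.
have fa0 : 0 <= f / a by rewrite divr_ge0// ltW.
have gb0 : 0 <= g / b by rewrite divr_ge0// ltW.
have z0 : 0 <= (1 - l) * (f / a) + l * (g / b).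
  by rewrite addr_ge0// mulr_ge0//; case/andP: l01 => *; lra.
have eqE : (f * b == g * a) = (f / a == g / b).
  by rewrite eqr_div ?lt0r_neq0.
rewrite RE fgE powRM//; last exact: ltW.
apply/leifP; rewrite eqE; case: ifPn => [/eqP ->|fg].
  by rewrite -!mulrDl subrK !mul1r.
by rewrite ltr_pM2l ?powR_gt0//; exact: powR_convex_strict.
Qed.

End strict_convexity.

Section minkowski_equality.
Local Open Scope ereal_scope.
Context d (T : measurableType d) (R : realType) (mu : {measure set T -> \bar R}).
Variables (Q : set T) (mQ : measurable Q) (f g : T -> R).
Hypotheses (mf : measurable_fun setT f) (mg : measurable_fun setT g).
Hypotheses (f0 : forall x, (0 <= f x)%R) (g0 : forall x, (0 <= g x)%R).

(** The majorant [rhs] integrates to exactly (a + b)^m. In the equality case the nonnegative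
    [rhs - lhs] therefore has integral 0 and vanishes almost everywhere, and the pointwise equality
    condition says what this means for f and g. *)
Lemma minkowski_powR (m a b : R) : (1 < m)%R -> (0 < a)%R -> (0 < b)%R ->
  \int[mu]_(x in Q) (f x `^ m)%:E = (a `^ m)%:E ->
  \int[mu]_(x in Q) (g x `^ m)%:E = (b `^ m)%:E ->
  \int[mu]_(x in Q) ((f x + g x) `^ m)%:E <= ((a + b) `^ m)%:E /\
  (\int[mu]_(x in Q) ((f x + g x) `^ m)%:E = ((a + b) `^ m)%:E ->
   mu (Q `&` [set x | f x * b != g x * a]%R) = 0).
Proof.
move=> m1 a0 b0 fE gE.
pose k := ((a + b) `^ m / (a + b))%R.
have ab0 : (0 < a + b)%R by rewrite addr_gt0.
have k0 : (0 < k)%R by rewrite divr_gt0// powR_gt0.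
pose rhs x := (k * (a * (f x / a) `^ m + b * (g x / b) `^ m))%R.
pose lhs x := ((f x + g x) `^ m)%R.
have lr x : (lhs x <= rhs x ?= iff (f x * b == g x * a))%R by exact: powRD_split.
have mp (h : T -> R) : measurable_fun setT h -> measurable_fun setT (fun x => h x `^ m)%R.
  by move=> mh; apply: (measurableT_comp (measurable_powR m)).
have ml : measurable_fun setT lhs by apply: mp; exact: measurable_funD.
have mr : measurable_fun setT rhs.
  apply: measurable_funM => //; apply: measurable_funD; apply: measurable_funM => //;
  by apply: mp; apply: measurable_funM.
have scale (h : T -> R) (c : R) : measurable_fun setT h -> (forall x, (0 <= h x)%R) ->
    (0 < c)%R -> \int[mu]_(x in Q) (h x `^ m)%:E = (c `^ m)%:E ->
    \int[mu]_(x in Q) (c * (h x / c) `^ m)%:E = c%:E.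
  move=> mh h0 c0 hE.
  rewrite (eq_integral (fun x => (c / c `^ m)%:E * (h x `^ m)%:E)); last first.
    move=> x _; rewrite -EFinM powRM ?invr_ge0 ?(ltW c0)//.
    by rewrite -powR_inv1 ?(ltW c0)// -powRrM mulN1r powRN; congr EFin; ring.
  rewrite ge0_integralZl//=.
  - by rewrite hE -EFinM divfK// gt_eqF// powR_gt0.
  - by apply/measurable_EFinP; apply: measurable_funTS; exact: mp.
  - by move=> x _; rewrite lee_fin powR_ge0.
  - by rewrite lee_fin divr_ge0 ?powR_ge0// ltW.
have rE : \int[mu]_(x in Q) (rhs x)%:E = ((a + b) `^ m)%:E.
  rewrite (eq_integral (fun x =>
    k%:E * ((a * (f x / a) `^ m)%:E + (b * (g x / b) `^ m)%:E)))//.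
  have mterm (h : T -> R) (c : R) : measurable_fun setT h ->
      measurable_fun Q (fun x => (c * (h x / c) `^ m)%:E).
    move=> mh; apply/measurable_EFinP; apply: measurable_funTS.
    by apply: measurable_funM => //; apply: mp; exact: measurable_funM.
  rewrite ge0_integralZl//=.
  - rewrite ge0_integralD//=.
    + rewrite (scale f a)// (scale g b)// -EFinD -EFinM /k divfK// gt_eqF//.
    + by move=> x _; rewrite lee_fin mulr_ge0 ?powR_ge0// ltW.
    + exact: mterm.
    + by move=> x _; rewrite lee_fin mulr_ge0 ?powR_ge0// ltW.
    + exact: mterm.
  - by apply: emeasurable_funD; exact: mterm.
  - by move=> x _; rewrite adde_ge0// lee_fin mulr_ge0 ?powR_ge0// ltW.
  - by rewrite lee_fin ltW.
have lr_int : \int[mu]_(x in Q) (lhs x)%:E <= \int[mu]_(x in Q) (rhs x)%:E.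
  apply: ge0_le_integral => //=.
  - by move=> x _; rewrite lee_fin powR_ge0.
  - by apply/measurable_EFinP; exact: measurable_funTS.
  - by apply/measurable_EFinP; exact: measurable_funTS.
  - by move=> x _; rewrite lee_fin; exact: (lr x).1.
split; first by rewrite -rE.
move=> lE.
have h0 x : (0 <= rhs x - lhs x)%R by rewrite subr_ge0; exact: (lr x).1.
have mh : measurable_fun setT (fun x => rhs x - lhs x)%R by exact: measurable_funB.
have hE : \int[mu]_(x in Q) (rhs x - lhs x)%:E = 0.
  have : \int[mu]_(x in Q) (rhs x)%:E =
      \int[mu]_(x in Q) (rhs x - lhs x)%:E + \int[mu]_(x in Q) (lhs x)%:E.
    rewrite -ge0_integralD//=.
    - by apply: eq_integral => x _; rewrite -EFinD subrK.
    - by move=> x _; rewrite lee_fin.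
    - by apply/measurable_EFinP; exact: measurable_funTS.
    - by move=> x _; rewrite lee_fin powR_ge0.
    - by apply/measurable_EFinP; exact: measurable_funTS.
  rewrite rE [X in _ = _ + X]lE => /esym/eqP.
  case: (integral _ _ _) => [r| |]//.
  by rewrite -EFinD eqe -[eqbRHS]add0r => /eqP/addIr ->.
have : \int[mu]_(x in Q) `|(rhs x - lhs x)%:E| = 0.
  by rewrite -[RHS]hE; apply: eq_integral => x _; rewrite gee0_abs// lee_fin.
move/ae_eq_integral_abs => /(_ mQ); case.
  by apply/measurable_EFinP; exact: measurable_funTS.
move=> N [mN N0 sN].
apply: (subset_measure0 _ mN _ N0) => //.
  apply: measurableI => //.
  by apply: measurable_set_neqr; exact: measurable_funM.
move=> x [Qx /= fgx]; apply: sN => /= /(_ Qx)/eqP; rewrite eqe subr_eq0 eq_sym.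
by rewrite (lr x).2; apply/negP.
Qed.

End minkowski_equality.

(** * Pseudo-cones *)

Lemma convex_setP (R : realType) (n : nat) (A : set 'rV[R]_n) (x y : 'rV[R]_n) (l : R) :
  convex_set A -> 0 <= l <= 1 -> A x -> A y -> A (l *: x + (1 - l) *: y).
Proof.
move=> cA /andP[l0 l1] Ax Ay.
have /set_mem := cA x y (Itv01 l0 l1) (mem_set Ax) (mem_set Ay).
by [].
Qed.

Lemma volume_large_balls (R : realType) (n : nat) (A : set 'rV[R]_n) :
  (0 < n)%N -> measurable A ->
  (forall r : R, 0 < r -> exists x, ball x r `<=` A) -> volume A = +oo%E.
Proof.
move=> n0 mA bA; apply/eqyP => M M0.
(* The maximum with 1 ensures (2s)^n >= 2s >= M for n > 0. *)
pose s := Num.max 1 M.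
have s1 : 1 <= s by rewrite le_max lexx.
have s0 : 0 < s by exact: lt_le_trans ltr01 s1.
have [x xA] := bA s s0.
have mb : measurable (ball x s) by exact: measurable_ball_row.
apply: (@le_trans _ _ (volume (ball x s))); last first.
  by apply: le_measure; rewrite ?inE.
rewrite volume_ball// lee_fin (@le_trans _ _ (s *+ 2))//.
  by rewrite (@le_trans _ _ s)// ?le_max ?lexx ?orbT// mulr2n lerDl ltW.
by apply: ler_eXnr => //; rewrite mulr2n (le_trans s1)// lerDl ltW.
Qed.

Section cone.
Context {R : realType} {n : nat}.
Variable C : set 'rV[R]_n.
Hypotheses (coneC : pointed_closed_convex_cone C) (C0 : interior C !=set0).

Lemma cone_closed : closed C. Proof. by case: coneC. Qed.

Lemma coneZ (l : R) x : 0 <= l -> C x -> C (l *: x).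
Proof. by case: coneC => _ _ + _; exact. Qed.

Lemma coneD x y : C x -> C y -> C (x + y).
Proof.
case: coneC => _ cC _ _ Cx Cy.
have h : 0 <= (2^-1 : R) <= 1 by apply/andP; split; lra.
have := coneZ (ler0n R 2) (convex_setP cC h Cx Cy).
have e1 : 2 * 2^-1 = 1 :> R by rewrite divff.
have e2 : 2 * (1 - 2^-1) = 1 :> R by rewrite mulrBr e1; lra.
by rewrite scalerDr !scalerA e1 e2 !scale1r.
Qed.

Lemma cone0 : C 0.
Proof. by have [v /interior_subset Cv] := C0; rewrite -(scale0r v); exact: coneZ. Qed.

Lemma cone_ball : exists v (r : R), 0 < r /\ ball v r `<=` C.
Proof.
by have [v /nbhs_ballP[r /= r0 rC]] := C0; exists v, r.
Qed.

Lemma cone_measurable : measurable C.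
Proof. by apply: closed_measurable_row; exact: cone_closed. Qed.

End cone.

Lemma ball_scale (R : realType) (n : nat) (x y : 'rV[R]_n) (r c : R) : 0 < c ->
  ball (c *: x) (c * r) y <-> ball x r (c^-1 *: y).
Proof.
move=> c0; rewrite mx_norm_ball /ball_ /=.
rewrite (_ : c *: x - y = c *: (x - c^-1 *: y)); last first.
  by rewrite scalerBr scalerA divff ?scale1r// gt_eqF.
by rewrite normrZ gtr0_norm// ltr_pM2l.
Qed.

Section pseudo_cone.
Context {R : realType} {n : nat}.
Variable C : set 'rV[R]_n.
Hypotheses (n0 : (0 < n)%N).
Hypotheses (coneC : pointed_closed_convex_cone C) (C0 : interior C !=set0).

(** The last clause makes [X] absorb translations by [C]; excluding the origin makes [radial]
    positive on every ray that meets [X]. *)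
Definition pseudo_cone (X : set 'rV[R]_n) :=
  [/\ X `<=` C, closed X, X !=set0, ~ X 0 &
      forall x v, X x -> C v -> X (x + v)].

(* If x + v is missing from X then so is the part of the cone with apex x
   spanned by a neighbourhood of v that lies beyond x + v, by convexity; it has
   infinite volume. *)
Lemma coconvex_recession A x v : coconvex C A ->
  (C `\` A) x -> interior C v -> (C `\` A) (x + v).
Proof.
move=> [AC Afin cX convX] Xx iv.
have mA : measurable A.
  rewrite (_ : A = C `\` (C `\` A)).
    apply: measurableD; first exact: cone_measurable.
    exact: closed_measurable_row.
  by rewrite setDD setIidr.
have Cx : C x by case: Xx.
apply: contrapT => nXv.
suff : volume A = +oo%E by move=> Aoo; move: Afin; rewrite Aoo.
have /nbhs_ballP[r1 /= r10 r1C] := iv.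
have : nbhs (x + v) (~` (C `\` A)).
  by apply: open_nbhs_nbhs; split => //; exact: closed_openC.
move=> /nbhs_ballP[r2 /= r20 r2X].
pose r := Num.min r1 r2.
have r0 : 0 < r by rewrite lt_min r10.
have key (s : R) w : 1 <= s -> ball v r w -> A (x + s *: w).
  move=> s1 vw.
  have s0 : 0 < s by exact: lt_le_trans ltr01 s1.
  have Cw : C w by apply: r1C; apply: le_ball vw; rewrite ge_min lexx.
  have Csw : C (x + s *: w) by apply: coneD => //; apply: coneZ => //; exact: ltW.
  (* Otherwise x + w, the convex combination of x + s w and x with weight 1/s, would lie in C \ A
     although it is within [r2] of x + v. *)
  apply: contrapT => nA.
  have s01 : 0 <= s^-1 <= 1 by rewrite invr_ge0 (ltW s0)/= invf_le1.
  have := convex_setP convX s01 (conj Csw nA) Xx.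
  rewrite scalerDr scalerA mulVf ?gt_eqF// scale1r addrAC -scalerDl addrC.
  rewrite (_ : s^-1 + (1 - s^-1) = 1) ?scale1r; last by ring.
  apply/r2X; rewrite addrC.
  move: vw; rewrite mx_norm_ball /ball_ /= opprD addrACA subrr add0r.
  move=> /lt_le_trans; apply.
  by rewrite ge_min lexx orbT.
apply: volume_large_balls => // t t0.
(* Then s r = r + t, so the ball of radius t about x + s v fits into x + s B(v, r), and s >= 1 as
   [key] requires. *)
pose s := 1 + t / r.
have s1 : 1 <= s by rewrite lerDl divr_ge0// ltW.
have s0 : 0 < s by exact: lt_le_trans ltr01 s1.
exists (x + s *: v) => y; rewrite mx_norm_ball /ball_/= => xy.
rewrite (_ : y = x + s *: (s^-1 *: (y - x))); last first.
  by rewrite scalerA divff ?gt_eqF// scale1r addrC subrK.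
apply: key => //; apply/ball_scale => //.
rewrite mx_norm_ball /ball_ /= opprB addrA [_ + x]addrC.
apply: (lt_le_trans xy); rewrite /s mulrDl mul1r divfK ?gt_eqF//.
by rewrite lerDr ltW.
Qed.

(** A vector w of C is the limit of the interior vectors w + t v, so closedness extends
    [coconvex_recession] to all of C. If C \ A were empty, A = C would contain arbitrarily large
    balls; if it contained the origin, it would contain C, and A would be empty. *)
Lemma coconvex_pseudo_cone A : coconvex C A -> A !=set0 -> pseudo_cone (C `\` A).
Proof.
move=> coA [a Aa]; have [AC Afin cX convX] := coA.
have [v [r [r0 rC]]] := cone_ball C0.
have iv : interior C v by apply/nbhs_ballP; exists r.
have X_rec x w : (C `\` A) x -> C w -> (C `\` A) (x + w).
  move=> Xx Cw.
  have : closure (C `\` A) (x + w).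
    move=> B /nbhs_ballP[e /= e0 eB].
    pose t := e / (2 * (`|v| + 1)).
    have v1 : 0 < `|v| + 1 by rewrite ltr_wpDl.
    have t0 : 0 < t by rewrite divr_gt0// mulr_gt0.
    exists (x + (w + t *: v)); split.
      apply: coconvex_recession => //.
      apply/nbhs_ballP; exists (t * r) => /=; first exact: mulr_gt0.
      move=> y wy; rewrite -(subrK w y) addrC; apply: coneD => //.
      rewrite -[y - w]scale1r -(divff (lt0r_neq0 t0)) -scalerA.
      apply: coneZ => //; first exact: ltW.
      apply: rC; apply/(ball_scale _ _ _ t0).
      by move: wy; rewrite mx_norm_ball /ball_/= opprB addrA [_ + w]addrC.
    apply: eB; rewrite mx_norm_ball /ball_/= addrA opprD addrA subrr sub0r normrN.
    rewrite normrZ gtr0_norm// /t mulrAC ltr_pdivrMr ?mulr_gt0// ltr_pM2l//.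
    by have := normr_ge0 v; lra.
  by move/closure_id : cX => <-.
split => //.
- apply: contrapT => /set0P/negP; rewrite negbK => /eqP X0.
  have CA : C `<=` A by move=> y Cy; apply: contrapT => nA; have : set0 y by rewrite -X0.
  have : volume C = +oo%E.
    apply: volume_large_balls => //; first exact: cone_measurable.
    move=> t t0; exists ((t / r) *: v) => y ty.
    have tr : 0 < t / r by rewrite divr_gt0.
    rewrite -[y]scale1r -(divff (lt0r_neq0 tr)) -scalerA.
    apply: coneZ => //; first exact: ltW.
    by apply: rC; apply/(ball_scale _ _ _ tr); rewrite divfK ?gt_eqF.
  have -> : C = A by apply/seteqP.
  by move=> Aoo; move: Afin; rewrite Aoo.
- move=> X0; have := X_rec _ _ X0 (AC _ Aa); rewrite add0r.
  by case.
Qed.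

End pseudo_cone.

(* [radial X x] is the least t > 0 with t *: x in X, and 0 when the ray
   through x misses X (since inf set0 = 0). *)
Definition radial (R : realType) (n : nat) (X : set 'rV[R]_n) (x : 'rV[R]_n) : R :=
  inf [set t | 0 < t /\ X (t *: x)].

Definition ray_meets (R : realType) (n : nat) (X : set 'rV[R]_n) : set 'rV[R]_n :=
  [set x | exists2 t : R, 0 < t & X (t *: x)].

(** * Radial functions of pseudo-cones *)

Section radial.
Context {R : realType} {n : nat}.
Variable C : set 'rV[R]_n.
Hypotheses (n0 : (0 < n)%N).
Hypotheses (coneC : pointed_closed_convex_cone C) (C0 : interior C !=set0).
Variable X : set 'rV[R]_n.
Hypothesis pX : pseudo_cone C X.
Implicit Types (x : 'rV[R]_n) (c s t : R).

Let cX : closed X. Proof. by case: pX. Qed.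
Let XC : X `<=` C. Proof. by case: pX. Qed.

Lemma pseudo_coneZ t x : 1 <= t -> X x -> X (t *: x).
Proof.
move=> t1 Xx; case: pX => _ _ _ _ Xrec.
rewrite (_ : t *: x = x + (t - 1) *: x).
  by apply: Xrec => //; apply: coneZ => //; [rewrite subr_ge0|exact: XC].
by rewrite scalerBl scale1r addrC subrK.
Qed.

Lemma radial_out x : ~ ray_meets X x -> radial X x = 0.
Proof.
move=> nE; rewrite /radial (_ : mkset _ = set0) ?inf0//.
by apply/seteqP; split => // t [t0 Xt]; case: nE; exists t.
Qed.

Let has_lb x : has_lbound [set t | 0 < t /\ X (t *: x)].
Proof. by exists 0 => t [/ltW]. Qed.

(** By [pseudo_coneZ] every s above the infimum is admissible, so closedness of X makes the infimum
    itself admissible; it is not 0 because X misses the origin. *)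
Lemma radial_in x : ray_meets X x -> 0 < radial X x /\ X (radial X x *: x).
Proof.
move=> [t0 t00 Xt0].
have X_gt s : radial X x < s -> X (s *: x).
  have ne : [set t | 0 < t /\ X (t *: x)] !=set0 by exists t0.
  move=> /(inf_lt ne)[t [t_gt0 Xt] ts].
  rewrite -(divfK (lt0r_neq0 t_gt0) s) -scalerA; apply: pseudo_coneZ => //.
  by rewrite ler_pdivlMr// mul1r ltW.
have X0 : X (radial X x *: x).
  suff : closure X (radial X x *: x) by move/closure_id : cX => <-.
  move=> B /nbhs_ballP[e /= e0 eB].
  have x1 : 0 < `|x| + 1 by rewrite ltr_wpDl.
  pose d := e / (`|x| + 1).
  have d0 : 0 < d by rewrite divr_gt0.
  exists ((radial X x + d) *: x); split; first by apply: X_gt; rewrite ltrDl.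
  apply: eB; rewrite mx_norm_ball /ball_/= scalerDl opprD addrA subrr sub0r normrN.
  rewrite normrZ gtr0_norm// /d mulrAC ltr_pdivrMr// ltr_pM2l//.
  by rewrite ltrDl.
split => //.
rewrite lt_neqAle; apply/andP; split; last first.
  by apply: lb_le_inf; [exists t0|move=> t [/ltW]].
apply/eqP => r0; case: pX => _ _ _ + _; apply.
by rewrite -(scale0r x) r0.
Qed.

Lemma radial_le s x : 0 < s -> X (s *: x) -> radial X x <= s.
Proof. by move=> s0 Xs; apply: ge_inf. Qed.

Lemma ray_meetsP s x : ray_meets X x -> 0 < s -> (X (s *: x) <-> radial X x <= s).
Proof.
move=> Ex s0; split; first exact: radial_le.
move=> rs; have [r0 Xr] := radial_in Ex.
rewrite -(divfK (lt0r_neq0 r0) s) -scalerA; apply: pseudo_coneZ => //.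
by rewrite ler_pdivlMr// mul1r.
Qed.

Lemma radial_ge0 x : 0 <= radial X x.
Proof.
have [/radial_in[/ltW]//|/radial_out->//] := pselect (ray_meets X x).
Qed.

Lemma ray_meetsZ c x : 0 < c -> ray_meets X (c *: x) <-> ray_meets X x.
Proof.
move=> c0; split => [] [t t0 Xt].
  by exists (t * c); [rewrite mulr_gt0|rewrite -scalerA].
by exists (t / c); [rewrite divr_gt0|rewrite scalerA divfK// gt_eqF].
Qed.

Lemma radialZ c x : 0 < c -> radial X (c *: x) = c^-1 * radial X x.
Proof.
move=> c0; have [Ex|nE] := pselect (ray_meets X x); last first.
  by rewrite !radial_out ?mulr0//; apply: contra_not nE => /(ray_meetsZ _ c0).
have Ecx : ray_meets X (c *: x) by apply/ray_meetsZ.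
have [r0 Xr] := radial_in Ex; have [rc0 Xrc] := radial_in Ecx.
apply/eqP; rewrite eq_le; apply/andP; split.
  apply: radial_le; first by rewrite mulr_gt0// invr_gt0.
  by rewrite scalerA mulrAC mulVf ?mul1r// gt_eqF.
rewrite mulrC ler_pdivrMr//; apply: radial_le; first by rewrite mulr_gt0.
by rewrite -scalerA.
Qed.

Lemma ray_meets_cone x : ray_meets X x -> C x.
Proof.
move=> [t t0 /XC Ct]; rewrite -[x]scale1r -(mulVf (lt0r_neq0 t0)) -scalerA.
by apply: coneZ => //; rewrite invr_ge0 ltW.
Qed.

Lemma measurable_pseudo_cone : measurable X.
Proof. exact: closed_measurable_row. Qed.

Lemma measurable_ray_meets : measurable (ray_meets X).
Proof.
(* Integer factors suffice, since a ray that has entered X stays in it. *)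
rewrite (_ : ray_meets X = \bigcup_k ((fun x => k.+1%:R *: x) @^-1` X)).
  apply: bigcupT_measurable => k; apply: measurable_preimage_scale.
  exact: measurable_pseudo_cone.
apply/seteqP; split => [x [t t0 Xt]|x [k _ Xk]]; last by exists k.+1%:R.
exists (Num.truncn t) => //=; have tk := truncnS_gt t.
rewrite -(divfK (lt0r_neq0 t0) _%:R) -scalerA; apply: pseudo_coneZ => //.
by rewrite ler_pdivlMr// mul1r ltW.
Qed.

(** The set {r > s} is everything for s < 0, [ray_meets X] for s = 0, where the default value 0
    matters, and [ray_meets X] minus the preimage of X under scaling by s for s > 0. *)
Lemma measurable_radial : measurable_fun setT (radial X).
Proof.
apply: (measurability _ (RGenOInfty.measurableE R)).
move=> _ [_ [s ->] <-]; rewrite setTI.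
have [s0|] := leP 0 s; last first.
  move=> s0; rewrite (_ : _ @^-1` _ = setT)//.
  apply/seteqP; split => // x _; rewrite /= in_itv/= andbT.
  exact: lt_le_trans s0 (radial_ge0 x).
have [->|s_neq0] := eqVneq s 0.
  rewrite (_ : _ @^-1` _ = ray_meets X); first exact: measurable_ray_meets.
  apply/seteqP; split => x /=; rewrite in_itv/= andbT.
    by move=> r0; apply: contrapT => /radial_out r00; rewrite r00 ltxx in r0.
  by move=> /radial_in[].
have {}s0 : 0 < s by rewrite lt_neqAle eq_sym s_neq0.
rewrite (_ : _ @^-1` _ = ray_meets X `\` ((fun x => s *: x) @^-1` X)).
  apply: measurableD; first exact: measurable_ray_meets.
  by apply: measurable_preimage_scale; exact: measurable_pseudo_cone.
apply/seteqP; split => x /=; rewrite in_itv/= andbT.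
  move=> rs; have Ex : ray_meets X x.
    apply: contrapT => /radial_out r00; rewrite r00 in rs.
    by have := lt_trans s0 rs; rewrite ltxx.
  by split => // /ray_meetsP -/(_ Ex s0); rewrite leNgt rs.
by move=> [Ex nX]; rewrite ltNge; apply/negP => /(ray_meetsP Ex s0).
Qed.

(** A ray that misses X lies in C \ X yet has radial value 0, hence the second term. *)
Lemma cone_setDE : C `\` X = [set x | 1 < radial X x] `|` (C `\` ray_meets X).
Proof.
apply/seteqP; split => [x [Cx nX]|x].
  have [Ex|nE] := pselect (ray_meets X x); last by right.
  left => /=; rewrite ltNge; apply/negP => /(ray_meetsP Ex ltr01).
  by rewrite scale1r.
move=> [/= r1|[Cx nE]].
  have Ex : ray_meets X x.
    apply: contrapT => /radial_out r00; rewrite r00 in r1.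
    by have := lt_trans ltr01 r1; rewrite ltxx.
  split; first exact: ray_meets_cone.
  by move=> Xx; move: r1; rewrite ltNge (radial_le ltr01)// scale1r.
by split => // Xx; apply: nE; exists 1; rewrite ?scale1r.
Qed.

Hypothesis volX : (volume (C `\` X) < +oo)%E.

(* The rays of C missing X form a cone contained in C \ X; scaling leaves it
   invariant, so its finite volume must vanish. *)
Lemma volume_ray_misses : volume (C `\` ray_meets X) = 0%E.
Proof.
set S := C `\` _.
have mS : measurable S.
  apply: measurableD; last exact: measurable_ray_meets.
  exact: cone_measurable.
have Sfin : volume S \is a fin_num.
  rewrite ge0_fin_numE//; apply: le_lt_trans volX; apply: le_measure; rewrite ?inE//.
    apply: measurableD; last exact: measurable_pseudo_cone.
    exact: cone_measurable.
  by rewrite cone_setDE; exact: subsetUr.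
have := @volume_scale R n 2 S (ltr0n _ _) mS.
rewrite (_ : _ @^-1` S = S).
  rewrite -(fineK Sfin) -EFinM => -[] v.
  have v0 : (1 - 2^-1 ^+ n) * fine (volume S) = 0 by rewrite mulrBl mul1r -v subrr.
  move: v0 => /eqP; rewrite mulf_eq0 => /orP[|/eqP->//].
  rewrite subr_eq0 => /eqP v1; have : (2^-1 : R) ^+ n < 1.
    by rewrite exprn_ilt1// -?lt0n// invf_lt1// ltr1n.
  by rewrite -v1 ltxx.
apply/seteqP; split => x /= [Cx nE]; split.
- rewrite -[x]scale1r -(@mulVf _ 2)// -scalerA; exact: coneZ.
- move=> [t t0 Xt]; apply: nE; exists (t / 2); first by rewrite divr_gt0.
  by rewrite scalerA divfK.
- exact: coneZ.
- move=> [t t0 Xt]; apply: nE; exists (t * 2); first by rewrite mulr_gt0.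
  by rewrite -scalerA.
Qed.

Lemma volume_cone_setD : volume (C `\` X) = volume [set x | 1 < radial X x].
Proof.
rewrite cone_setDE measureU0//.
- by apply: measurable_set_ltr => //; exact: measurable_radial.
- apply: measurableD; last exact: measurable_ray_meets.
  exact: cone_measurable.
- exact: volume_ray_misses.
Qed.

Lemma volume_cone_setD_gt0 : (0 < volume (C `\` X))%E.
Proof.
have [v [r [r0 rC]]] := cone_ball C0.
have : nbhs (0 : 'rV[R]_n) (~` X).
  by apply: open_nbhs_nbhs; split; [exact: closed_openC|case: pX].
move=> /nbhs_ballP[e /= e0 eX].
(* With t(|v| + r) = e/2, the scaled ball stays in C and so close to the origin that it misses X. *)
pose t := e / (2 * (`|v| + r)).
have vr : 0 < `|v| + r by rewrite ltr_wpDl.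
have t0 : 0 < t by rewrite divr_gt0// mulr_gt0.
apply: (@lt_le_trans _ _ (volume (ball (t *: v) (t * r)))).
  have tr0 : 0 < t * r by rewrite mulr_gt0.
  rewrite volume_ball//.
  have : 0 < (t * r *+ 2) ^+ n by rewrite exprn_gt0// mulrn_wgt0.
  by rewrite -lte_fin.
apply: le_measure; rewrite ?inE.
- by apply: measurable_ball_row; rewrite mulr_gt0.
- apply: measurableD; last exact: measurable_pseudo_cone.
  exact: cone_measurable.
move=> y ty; split.
  rewrite -[y]scale1r -(divff (lt0r_neq0 t0)) -scalerA.
  by apply: coneZ => //; [exact: ltW|apply: rC; exact/(ball_scale _ _ _ t0)].
apply: eX; move: ty; rewrite mx_norm_ball /ball_/= sub0r normrN => ty.
rewrite -(subrK (t *: v) y); apply: (le_lt_trans (ler_normD _ _)).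
rewrite distrC normrZ (gtr0_norm t0) -ltrBrDr (lt_le_trans ty)//.
rewrite lerBrDr -mulrDr /t mulrAC ler_pdivrMr ?mulr_gt0//.
by rewrite ler_pM2l//; lra.
Qed.

End radial.

(** * Dilates, and recovering a pseudo-cone from its radial function *)

Section dilate.
Context {R : realType} {n : nat}.
Implicit Types (A X : set 'rV[R]_n) (x : 'rV[R]_n) (a : R).

Lemma dilateE a A : 0 < a -> dilate a A = (fun x => a^-1 *: x) @^-1` A.
Proof.
move=> a0; apply/seteqP; split => [_ [x Ax <-]|x Ax] /=.
  by rewrite scalerA mulVf ?scale1r// gt_eqF.
by exists (a^-1 *: x); rewrite // scalerA divff ?scale1r// gt_eqF.
Qed.

Lemma dilate_mem a A x : 0 < a -> dilate a A (a *: x) <-> A x.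
Proof.
by move=> a0; rewrite dilateE//= scalerA mulVf ?scale1r// gt_eqF.
Qed.

Lemma volume_dilate a A : 0 < a -> measurable A ->
  volume (dilate a A) = ((a ^+ n)%:E * volume A)%E.
Proof. by move=> a0 mA; rewrite dilateE// volume_scale ?invr_gt0// invrK. Qed.

Lemma measurable_dilate a A : 0 < a -> measurable A -> measurable (dilate a A).
Proof. by move=> a0 mA; rewrite dilateE//; exact: measurable_preimage_scale. Qed.

Lemma dilate_setD a C A : 0 < a -> pointed_closed_convex_cone C ->
  C `\` dilate a A = dilate a (C `\` A).
Proof.
move=> a0 coneC; rewrite !dilateE//.
apply/seteqP; split => x /= [Cx nA]; split => //.
  by apply: coneZ => //; rewrite invr_ge0 ltW.
by rewrite -[x]scale1r -(divff (lt0r_neq0 a0)) -scalerA; apply: coneZ => //; exact: ltW.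
Qed.

Lemma pseudo_cone_dilate a C X : 0 < a -> pointed_closed_convex_cone C ->
  pseudo_cone C X -> pseudo_cone C (dilate a X).
Proof.
move=> a0 coneC [XC cX [x0 Xx0] X0 Xrec].
have aV0 : 0 <= a^-1 by rewrite invr_ge0 ltW.
split.
- by move=> _ [x /XC Cx <-]; apply: coneZ => //; exact: ltW.
- rewrite dilateE//; apply: preimage_closed => // x _; exact: scaler_continuous.
- by exists (a *: x0); exists x0.
- by rewrite -(scaler0 _ a) dilate_mem.
- by move=> x v; rewrite dilateE//= scalerDr => Xx Cv; apply: Xrec => //; exact: coneZ.
Qed.

Lemma radial_dilate a C X x : 0 < a -> pointed_closed_convex_cone C ->
  pseudo_cone C X -> radial (dilate a X) x = a * radial X x.
Proof.
move=> a0 coneC pX; rewrite -[a in RHS]invrK -(@radialZ _ _ C)// ?invr_gt0//.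
rewrite /radial dilateE//; congr inf.
by apply/seteqP; split => t /= [t0 Xt]; split => //; move: Xt; rewrite !scalerA mulrC.
Qed.

End dilate.

Section radial_inj.
Context {R : realType} {n : nat}.
Variable C : set 'rV[R]_n.
Hypotheses (coneC : pointed_closed_convex_cone C) (C0 : interior C !=set0).

(** For x in X but not in Y, a small ball about x + t v lies in x + C, hence in X, and still misses
    the closed set Y. On that ball the two radial functions differ, and its volume is positive. *)
Lemma radial_ae_subset X Y : pseudo_cone C X -> pseudo_cone C Y ->
  volume [set x | radial X x != radial Y x] = 0%E -> X `<=` Y.
Proof.
move=> pX pY XY0 x Xx; apply: contrapT => nYx.
have [v [r [r0 rC]]] := cone_ball C0.
have : nbhs x (~` Y).
  by apply: open_nbhs_nbhs; split => //; apply: closed_openC; case: pY.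
move=> /nbhs_ballP[e /= e0 eY].
pose t := e / (2 * (`|v| + r)).
have vr : 0 < `|v| + r by rewrite ltr_wpDl.
have t0 : 0 < t by rewrite divr_gt0// mulr_gt0.
have tr0 : 0 < t * r by rewrite mulr_gt0.
pose B := ball (x + t *: v) (t * r).
suff : (volume B <= 0)%E.
  have Bgt0 : 0 < (t * r *+ 2) ^+ n by rewrite exprn_gt0// mulrn_wgt0.
  by rewrite volume_ball// lee_fin leNgt Bgt0.
rewrite -XY0; apply: le_measure; rewrite ?inE.
- exact: measurable_ball_row.
- have mX : measurable_fun setT (radial X) by exact: (measurable_radial coneC).
  have mY : measurable_fun setT (radial Y) by exact: (measurable_radial coneC).
  exact: measurable_set_neqr.
move=> y xty.
have Xy : X y.
  rewrite -(subrK x y) addrC; case: pX => _ _ _ _; apply => //.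
  rewrite -[y - x]scale1r -(divff (lt0r_neq0 t0)) -scalerA.
  apply: coneZ => //; first exact: ltW.
  apply: rC; apply/(ball_scale _ _ _ t0).
  by move: xty; rewrite /B mx_norm_ball /ball_/= opprB addrA [_ + x]addrC.
have nYy : ~ Y y.
  apply: eY; move: xty; rewrite /B mx_norm_ball /ball_/= => xty.
  rewrite (_ : x - y = (x + t *: v - y) - t *: v); last first.
    by rewrite [RHS]addrAC addrK.
  apply: (le_lt_trans (ler_normB _ _)).
  rewrite normrZ (gtr0_norm t0) -ltrBrDr (lt_le_trans xty)//.
  rewrite lerBrDr -mulrDr /t mulrAC ler_pdivrMr ?mulr_gt0//.
  by rewrite ler_pM2l//; lra.
have EX : ray_meets X y by exists 1; rewrite ?scale1r.
have [rX _] := radial_in coneC pX EX.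
have rX1 : radial X y <= 1 by apply: radial_le; rewrite ?scale1r.
apply/eqP => rXY.
(* If the ray misses Y, then [radial Y y] is the default 0 while [radial X y] is positive. *)
have [EY|nEY] := pselect (ray_meets Y y); last first.
  by move: rX; rewrite rXY radial_out// ltxx.
apply: nYy; rewrite -[y]scale1r; apply/(ray_meetsP coneC pY EY ltr01).
by rewrite -rXY.
Qed.

Lemma radial_ae_inj X Y : pseudo_cone C X -> pseudo_cone C Y ->
  volume [set x | radial X x != radial Y x] = 0%E -> X = Y.
Proof.
move=> pX pY XY0; apply/seteqP; split; apply: radial_ae_subset => //.
by rewrite -[RHS]XY0; congr volume; apply/seteqP; split => x /=; rewrite eq_sym.
Qed.

End radial_inj.

(** * Separation by directions in the interior of the polar cone *)

Section dotmul.
Context {R : realType} {n : nat}.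
Implicit Types (x y z u w : 'rV[R]_n) (X C : set 'rV[R]_n) (c : R).

Lemma dotmulC x y : dotmul x y = dotmul y x.
Proof. by apply: eq_bigr => i _; rewrite mulrC. Qed.

Lemma dotmulDl x y z : dotmul (x + y) z = dotmul x z + dotmul y z.
Proof. by rewrite -big_split; apply: eq_bigr => i _; rewrite mxE mulrDl. Qed.

Lemma dotmulZl c x y : dotmul (c *: x) y = c * dotmul x y.
Proof. by rewrite mulr_sumr; apply: eq_bigr => i _; rewrite mxE mulrA. Qed.

Lemma dotmulNl x y : dotmul (- x) y = - dotmul x y.
Proof. by rewrite -scaleN1r dotmulZl mulN1r. Qed.

Lemma dotmulDr x y z : dotmul x (y + z) = dotmul x y + dotmul x z.
Proof. by rewrite dotmulC dotmulDl !(dotmulC x). Qed.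

Lemma dotmulZr c x y : dotmul x (c *: y) = c * dotmul x y.
Proof. by rewrite dotmulC dotmulZl dotmulC. Qed.

Lemma dotmulNr x y : dotmul x (- y) = - dotmul x y.
Proof. by rewrite dotmulC dotmulNl dotmulC. Qed.

Lemma dotmul0r x : dotmul x 0 = 0.
Proof. by rewrite -(scale0r (0 : 'rV[R]_n)) dotmulZr mul0r. Qed.

Lemma dotmul_selfD x y :
  dotmul (x + y) (x + y) = dotmul x x + 2 * dotmul x y + dotmul y y.
Proof. by rewrite !dotmulDl !dotmulDr (dotmulC y x); ring. Qed.

Lemma normr_coord x i : `|x ord0 i| <= `|x|.
Proof.
rewrite (_ : `|x| = mx_norm x)// mx_normrE.
by apply/bigmax_geP; right => /=; exists (ord0, i).
Qed.

(** The topology is that of the max norm while separation uses the Euclidean product; this bound and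
    [dotmul_le] compare the two. *)
Lemma dotmul_self_ge x : `|x| ^+ 2 <= dotmul x x.
Proof.
have sq i : 0 <= x ord0 i * x ord0 i by rewrite -expr2 sqr_ge0.
have [x0|/mx_norm_neq0[[i j] /=]] := eqVneq (mx_norm x) 0.
  by rewrite [`|x|]x0 expr0n/= sumr_ge0.
rewrite ord1 => xj; rewrite [`|x|]xj real_normK ?num_real//.
by rewrite /dotmul (bigD1 j)//= expr2 lerDl sumr_ge0.
Qed.

Lemma dotmul_self_gt0 x : x != 0 -> 0 < dotmul x x.
Proof.
by move=> x0; apply: lt_le_trans (dotmul_self_ge x); rewrite exprn_gt0// normr_gt0.
Qed.

Lemma dotmul_le x y : dotmul x y <= n%:R * (`|x| * `|y|).
Proof.
rewrite (le_trans (ler_norm _))// (le_trans (ler_norm_sum _ _ _))//.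
rewrite (@le_trans _ _ (\sum_(i < n) `|x| * `|y|))//.
  by apply: ler_sum => i _; rewrite normrM ler_pM// normr_coord.
by rewrite sumr_const card_ord -[leLHS]mulr_natl.
Qed.

Lemma continuous_dotmul (f g : 'rV[R]_n -> 'rV[R]_n) :
  continuous f -> continuous g -> continuous (fun x => dotmul (f x) (g x)).
Proof.
move=> cf cg; rewrite /dotmul.
have ccoord (h : 'rV[R]_n -> 'rV[R]_n) i : continuous h -> continuous (fun x => h x ord0 i).
  move=> ch x; apply: (@continuous_comp _ _ _ h (fun y : 'rV[R]_n => y ord0 i)).
    exact: ch.
  exact: coord_continuous.
apply: continuous_big => [|i _ x]; first exact: add_continuous.
by apply: continuousM; exact: ccoord.
Qed.

Lemma continuous_dotmull u : continuous (fun x => dotmul x u).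
Proof. by apply: (@continuous_dotmul id (cst u)) => x; [exact: cvg_id|exact: cst_continuous]. Qed.

Lemma nearest_point X x : closed X -> X !=set0 ->
  exists2 y, X y & forall z, X z -> dotmul (x - y) (x - y) <= dotmul (x - z) (x - z).
Proof.
move=> cX [x0 Xx0].
pose f z := dotmul (x - z) (x - z).
have f0 z : 0 <= f z by apply: le_trans (dotmul_self_ge _); rewrite exprn_ge0.
(* The first term keeps [x0] in [K]. By the second, a point z of X outside [K] has f z >= |x - z|^2
   > (f x0 + 1)^2 >= f x0. *)
pose r := Num.max `|x - x0| (f x0 + 1).
pose K := X `&` [set z | `|x - z| <= r].
have cB : continuous (fun z : 'rV[R]_n => x - z).
  by move=> z; apply: continuousB; [exact: cst_continuous|exact: cvg_id].
have cf : continuous f.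
  by apply: continuous_dotmul.
have cN : continuous (fun z => `|x - z|).
  move=> z; apply: (@continuous_comp _ _ _ (fun z => x - z)); last exact: norm_continuous.
  exact: cB.
have cK : compact K.
  apply: bounded_closed_compact.
    exists (`|x| + r); split; first exact: num_real.
    move=> M xrM z [_ /= xz]; rewrite -[z](subrK x) (le_trans (ler_normD _ _))//.
    by rewrite distrC addrC (le_trans _ (ltW xrM))// lerD2l.
  apply: closedI => //.
  rewrite (_ : mkset _ = (fun z => `|x - z|) @^-1` [set y | y <= r])//.
  by apply: preimage_closed; [move=> z _; exact: cN|exact: closed_le].
have K0 : K !=set0 by exists x0; split => //=; rewrite le_max lexx.
have [y yK ymin] := EVT_min_rV K0 cK (continuous_subspaceT cf).
have [Xy xy] := set_mem yK.
exists y => // z Xz.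
have [xz|xz] := leP `|x - z| r; first by apply: ymin; exact/mem_set.
have /ymin fy0 : x0 \in K by apply/mem_set; split => //=; rewrite le_max lexx.
apply: (le_trans fy0); apply: le_trans (dotmul_self_ge _).
have fz : f x0 + 1 < `|x - z| by apply: le_lt_trans xz; rewrite le_max lexx orbT.
have h0 := f0 x0.
rewrite -/(f x0) expr2 (@le_trans _ _ ((f x0 + 1) * (f x0 + 1)))//; first nra.
by rewrite ler_pM// ?ltW//; lra.
Qed.

(** The normal is x - y with y the nearest point of X: a z in X beyond the hyperplane through y
    would allow a step from y towards z that comes closer to x. *)
Lemma closed_convex_separation X x : closed X -> convex_set X -> X !=set0 -> ~ X x ->
  exists u s, (forall z, X z -> dotmul z u <= s) /\ s < dotmul x u.
Proof.
move=> cX convX X0 nXx.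
have [y Xy ymin] := nearest_point x cX X0.
exists (x - y), (dotmul y (x - y)); split; last first.
  rewrite -subr_gt0 -dotmulNl -dotmulDl dotmul_self_gt0// subr_eq0.
  by apply: contra_not_neq nXx => ->.
move=> z Xz; rewrite -subr_le0 -dotmulNl -dotmulDl leNgt; apply/negP.
set P := dotmul (z - y) (x - y) => P0.
pose Q := dotmul (z - y) (z - y).
have Q0 : 0 <= Q by apply: le_trans (dotmul_self_ge _); rewrite exprn_ge0.
have Q1 : 0 < Q + 1 by rewrite ltr_wpDl.
(* The squared distance changes by -2lP + l^2 Q, which is negative as soon as l(Q + 1) <= P. *)
pose l := Num.min 1 (P / (Q + 1)).
have l0 : 0 < l by rewrite lt_min ltr01 divr_gt0.
have l01 : 0 <= l <= 1 by rewrite (ltW l0) ge_min lexx.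
have := ymin _ (convex_setP convX l01 Xz Xy).
rewrite (_ : x - (l *: z + (1 - l) *: y) = (x - y) + (- l) *: (z - y)); last first.
  by apply/rowP => i; rewrite !mxE; ring.
rewrite [leRHS]dotmul_selfD dotmulZr [dotmul (x - y) (z - y)]dotmulC -/P dotmulZl dotmulZr -/Q.
have lP : l * (Q + 1) <= P by rewrite -ler_pdivlMr// ge_min lexx orbT.
by nra.
Qed.

End dotmul.

(** * The interior of the polar cone *)

Section polar.
Context {R : realType} {n : nat}.
Variable C : set 'rV[R]_n.
Hypotheses (n0 : (0 < n)%N).
Hypotheses (coneC : pointed_closed_convex_cone C) (C0 : interior C !=set0).
Implicit Types (x y z u w : 'rV[R]_n) (c : R).

Lemma polarZ c u : 0 <= c -> polar C u -> polar C (c *: u).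
Proof. by move=> c0 Pu y Cy; rewrite dotmulZl mulr_ge0_le0// Pu. Qed.

Lemma polarD u w : polar C u -> polar C w -> polar C (u + w).
Proof. by move=> Pu Pw y Cy; rewrite dotmulDl -[0]addr0 lerD ?Pu ?Pw. Qed.

Lemma polar_interiorZ c u : 0 < c -> interior (polar C) u -> interior (polar C) (c *: u).
Proof.
move=> c0 /nbhs_ballP[r /= r0 rP]; apply/nbhs_ballP; exists (c * r) => /=.
  by rewrite mulr_gt0.
move=> y /(ball_scale _ _ _ c0)/rP Py.
by rewrite -[y]scale1r -(divff (lt0r_neq0 c0)) -scalerA; apply: polarZ => //; exact: ltW.
Qed.

Lemma polar_interiorD u w : polar C u -> interior (polar C) w ->
  interior (polar C) (u + w).
Proof.
move=> Pu /nbhs_ballP[r /= r0 rP]; apply/nbhs_ballP; exists r => // y uwy.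
rewrite -(subrK u y) addrC; apply: polarD => //; apply: rP.
by move: uwy; rewrite mx_norm_ball /ball_/= opprB addrA [_ + u]addrC.
Qed.

(** Pointedness puts -x outside C. A functional separating -x from C is bounded above on a cone,
    hence nonpositive there, and it is positive at -x. *)
Lemma polar_neg x : C x -> x != 0 -> exists2 u, polar C u & dotmul u x < 0.
Proof.
move=> Cx x0; have [cC convC _ pC] := coneC.
have nCx : ~ C (- x).
  move=> CNx; have : (C `&` [set - y | y in C]) x.
    by split => //; exists (- x); rewrite ?opprK.
  by rewrite pC => /eqP; rewrite (negbTE x0).
have C_ne : C !=set0 by exists x.
have [u [s [us sx]]] := closed_convex_separation cC convC C_ne nCx.
have s0 : 0 <= s by rewrite -(dotmul0r u) dotmulC; apply: us; exact: cone0.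
exists u; last by move: sx; rewrite dotmulC dotmulNr; lra.
move=> z Cz; rewrite leNgt dotmulC; apply/negP => zu.
have := us _ (coneZ coneC (ltW (divr_gt0 (ltr_pwDr ltr01 s0) zu)) Cz).
by rewrite dotmulZl divfK ?gt_eqF//; lra.
Qed.

(** The slice [K] of C by the max-norm unit sphere is compact, so finitely many functionals from
    [polar_neg] suffice to be negative somewhere at each point of [K]. Their sum is negative on all
    of [K], and by compactness it is bounded away from 0. *)
Lemma polar_interior_nonempty : interior (polar C) !=set0.
Proof.
have [cC _ _ _] := coneC.
pose K := C `&` [set x | `|x| = 1].
have cK : compact K.
  apply: bounded_closed_compact.
    exists 1; split; first exact: num_real.
    by move=> M M1 z [_ /= ->]; exact: ltW.
  apply: closedI => //.
  rewrite (_ : mkset _ = (fun z : 'rV[R]_n => `|z|) @^-1` [set 1])//.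
  by apply: preimage_closed; [move=> z _; exact: norm_continuous|exact: closed_eq].
have K_sub x : C x -> x != 0 -> K (`|x|^-1 *: x).
  move=> Cx x0; split; first by apply: coneZ => //; rewrite invr_ge0.
  by rewrite /= normrZ normfV normr_id mulVf// normr_eq0.
have [w [Pw Kw]] : exists w, polar C w /\ forall x, K x -> dotmul x w < 0.
  have := cK; rewrite compact_cover.
  move=> /(_ _ (polar C) (fun u => [set x | dotmul x u < 0]))[].
  - move=> u _; rewrite (_ : mkset _ = (fun x => dotmul x u) @^-1` [set y | y < 0])//.
    by move/continuousP: (@continuous_dotmull R n u); apply; exact: open_lt.
  - move=> x [Cx /= x1]; have x0 : x != 0 by rewrite -normr_eq0 x1 oner_neq0.
    by have [u Pu ux] := polar_neg Cx x0; exists u => //=; rewrite dotmulC.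
  move=> D' D'P KD'; pose D : seq 'rV[R]_n := finmap.enum_fset D'.
  have DP u : u \in D -> polar C u by move=> /D'P/set_mem.
  have KD x : K x -> exists2 u, u \in D & dotmul x u < 0 by move=> /KD'[u]; exists u.
  exists (\sum_(u <- D) u); split.
    rewrite big_seq; elim/big_ind : _ => [y _|u w|u uD].
    - by rewrite dotmulC dotmul0r.
    - exact: polarD.
    - exact: DP.
  move=> x Kx; have [u uD ux] := KD _ Kx.
  rewrite (big_rem u)//= dotmulDr -[ltRHS]addr0 ltr_leD//.
  rewrite dotmulC; suff : polar C (\sum_(y <- rem u D) y) by apply; case: Kx.
  rewrite big_seq; elim/big_ind : _ => [y _|v w|v /mem_rem vD].
  - by rewrite dotmulC dotmul0r.
  - exact: polarD.
  - exact: DP.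
exists w; apply/nbhs_ballP.
have [K0|/set0P K0] := eqVneq K set0.
  exists 1 => //= u _ x Cx; have [->|x0] := eqVneq x 0; first by rewrite dotmul0r.
  by have := K_sub _ Cx x0; rewrite K0.
have [c cKc cmax] := EVT_max_rV K0 cK (continuous_subspaceT (@continuous_dotmull R n w)).
pose m := - dotmul c w.
have m0 : 0 < m by rewrite oppr_gt0; apply: Kw; exact: set_mem.
(* By [dotmul_le], a perturbation of w smaller than m/n changes the product with x by at most m
   |x|. *)
exists (m / n%:R) => /=; first by rewrite divr_gt0// ltr0n.
move=> u wu x Cx; have [->|x0] := eqVneq x 0; first by rewrite dotmul0r.
have xn0 : 0 < `|x| by rewrite normr_gt0.
rewrite -(subrK w u) dotmulDl.
have h1 : dotmul w x <= - m * `|x|.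
  have := cmax _ (mem_set (K_sub _ Cx x0)).
  by rewrite /m opprK dotmulZl dotmulC mulrC ler_pdivrMr// dotmulC.
have h2 : dotmul (u - w) x <= m * `|x|.
  apply: (le_trans (dotmul_le _ _)); rewrite mulrA ler_pM2r//.
  rewrite mulrC -ler_pdivlMr ?ltr0n// ltW// distrC.
  by move: wu; rewrite mx_norm_ball.
by lra.
Qed.

(** Plain separation yields a u that may lie on the boundary of the polar cone. Adding a small
    multiple of an interior [w0] moves it inside: [w0] is nonpositive on X, so the bound s survives,
    and a small factor preserves the gap at x. *)
Lemma Omega_separation X x : pseudo_cone C X -> convex_set X -> ~ X x ->
  exists2 u, Omega C u & sup [set dotmul u y | y in X] < dotmul x u.
Proof.
move=> [XC cX X_ne X0 Xrec] convX nXx.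
have [u [s [us sx]]] := closed_convex_separation cX convX X_ne nXx.
have [y0 Xy0] := X_ne.
have Pu : polar C u.
  move=> z Cz; rewrite leNgt dotmulC; apply/negP => zu.
  (* Chosen so that y0 + t z, still in X, has product with u above s. *)
  pose t := (`|s - dotmul y0 u| + 1) / dotmul z u.
  have t0 : 0 <= t by rewrite divr_ge0 ?(ltW zu)// addr_ge0.
  have := us _ (Xrec _ _ Xy0 (coneZ coneC t0 Cz)).
  rewrite dotmulDl dotmulZl divfK ?gt_eqF//.
  by have := ler_norm (s - dotmul y0 u); lra.
have [w0 iw0] := polar_interior_nonempty.
pose e := (dotmul x u - s) / (2 * (`|dotmul x w0| + 1)).
have xw1 : 0 < `|dotmul x w0| + 1 by rewrite ltr_wpDl.
have e0 : 0 < e by rewrite divr_gt0 ?subr_gt0// mulr_gt0.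
pose v := u + e *: w0.
have iv : interior (polar C) v by apply: polar_interiorD => //; exact: polar_interiorZ.
have Xv z : X z -> dotmul z v <= s.
  move=> Xz; rewrite dotmulDr -[s]addr0 lerD ?us// dotmulC.
  by apply: (polarZ (ltW e0) (interior_subset iw0)); exact: XC.
have xv : s < dotmul x v.
  rewrite dotmulDr dotmulZr.
  have h : e * `|dotmul x w0| < dotmul x u - s.
    rewrite /e mulrAC ltr_pdivrMr ?mulr_gt0// ltr_pM2l ?subr_gt0//.
    by have := normr_ge0 (dotmul x w0); lra.
  have : - (e * `|dotmul x w0|) <= e * dotmul x w0.
    by rewrite -mulrN ler_pM2l// lerNl ler_normr lexx orbT.
  by lra.
have v0 : v != 0.
  apply/eqP => v0; have := Xv _ Xy0; move: xv; rewrite v0 !dotmul0r.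
  by move=> /lt_le_trans /[apply]; rewrite ltxx.
have ev0 : 0 < enorm v by rewrite sqrtr_gt0 dotmul_self_gt0.
exists ((enorm v)^-1 *: v).
  split; last by apply: polar_interiorZ => //; rewrite invr_gt0.
  rewrite /unit_sphere/= /enorm dotmulZl dotmulZr mulrA -expr2.
  rewrite sqrtrM ?sqr_ge0// sqrtr_sqr gtr0_norm ?invr_gt0//.
  by rewrite mulVf// gt_eqF.
apply: (@le_lt_trans _ _ ((enorm v)^-1 * s)).
  apply: ge_sup; first by exists (dotmul ((enorm v)^-1 *: v) y0); exists y0.
  by move=> _ [z Xz <-]; rewrite dotmulZl ler_pM2l ?invr_gt0// dotmulC; exact: Xv.
by rewrite dotmulZr ltr_pM2l ?invr_gt0.
Qed.

End polar.

(** * The Brunn-Minkowski inequality *)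

(** Minkowski's equality case speaks only of the unit ball; homogeneity carries it to the whole
    space, as [D] is a countable union of shells of volume 0. *)
Lemma homog0_null (R : realType) (n : nat) (D : set 'rV[R]_n) : (0 < n)%N ->
  measurable D -> homog0 D ->
  volume ([set x | `|x| < 1] `&` D) = 0%E -> volume D = 0%E.
Proof.
move=> n0 mD hD QD0.
have mF k : measurable ([set x : 'rV[R]_n | `|x| ^+ n < k.+1%:R] `&` D).
  apply: measurableI => //; apply: measurable_set_ltr => //.
  by apply: measurable_funX; exact: measurable_norm_row.
apply/negligibleP => //.
rewrite (_ : D = \bigcup_k ([set x | `|x| ^+ n < k.+1%:R] `&` D)).
  apply: negligible_bigcup => k; apply/negligibleP => //.
  by apply: eq_trans (volume_shell n0 mD hD (ler0n _ _)) _; rewrite QD0 mule0.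
apply/seteqP; split => [x Dx|x [k _ []]//].
by exists (Num.truncn (`|x| ^+ n)) => //; split => //; exact: truncnS_gt.
Qed.

Lemma sup_scale (R : realType) (S : set R) (a : R) : 0 < a -> has_sup S ->
  sup [set a * s | s in S] = a * sup S.
Proof.
move=> a0 [S0 [M MS]]; have ubS : has_ubound S by exists M.
have [s0 Ss0] := S0.
apply/eqP; rewrite eq_le; apply/andP; split.
  apply: ge_sup; first by exists (a * s0); exists s0.
  by move=> _ [s Ss <-]; rewrite ler_pM2l//; exact: ub_le_sup.
rewrite -ler_pdivlMl//; apply: ge_sup => // s Ss.
rewrite ler_pdivlMl//; apply: ub_le_sup; last by exists s.
by exists (a * M) => _ [t St <-]; rewrite ler_pM2l//; exact: MS.
Qed.

Lemma ltr1_powR (R : realType) (q s : R) : 0 < q -> 0 <= s ->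
  (1 < s `^ q) = (1 < s).
Proof.
move=> q0 s0; have e1 : 1 `^ q = 1 :> R by rewrite powR1.
apply/idP/idP => [|s1]; last by rewrite -e1 gt0_ltr_powR ?nnegrE.
by apply: contraTT; rewrite -!leNgt => s1; rewrite -e1 ge0_ler_powR ?nnegrE// ltW.
Qed.

Section cosum.
Context {R : realType} {n : nat}.
Variables (C : set 'rV[R]_n).
Hypotheses (n0 : (0 < n)%N).
Hypotheses (coneC : pointed_closed_convex_cone C) (C0 : interior C !=set0).
Implicit Types (A : set 'rV[R]_n) (x u : 'rV[R]_n) (p : R).

Lemma has_sup_cosupport A u : pseudo_cone C (C `\` A) -> polar C u ->
  has_sup [set dotmul u y | y in C `\` A].
Proof.
move=> [XC _ [y Xy] _ _] Pu; split; first by exists (dotmul u y); exists y.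
by exists 0 => _ [z Xz <-]; apply: Pu; exact: XC.
Qed.

Lemma cosupport_ge0 A u : pseudo_cone C (C `\` A) -> polar C u ->
  0 <= cosupport C A u.
Proof.
move=> pX Pu; rewrite /cosupport oppr_ge0.
apply: ge_sup; first by have [] := has_sup_cosupport pX Pu.
by move=> _ [z [Cz _] <-]; exact: Pu.
Qed.

Lemma cosupport_radial A u x : pseudo_cone C (C `\` A) -> polar C u ->
  ray_meets (C `\` A) x -> cosupport C A u <= radial (C `\` A) x * - dotmul x u.
Proof.
move=> pX Pu Ex; rewrite mulrN lerN2 -dotmulZl dotmulC.
have [_ ub] := has_sup_cosupport pX Pu.
apply: ub_le_sup => //; exists (radial (C `\` A) x *: x) => //.
by have [] := radial_in coneC pX Ex.
Qed.

Lemma cosupport_dilate A u a : 0 < a -> pseudo_cone C (C `\` A) -> polar C u ->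
  cosupport C (dilate a A) u = a * cosupport C A u.
Proof.
move=> a0 pX Pu; rewrite /cosupport dilate_setD// mulrN -sup_scale//; last first.
  exact: has_sup_cosupport.
congr (- sup _); apply/seteqP; split => [_ [_ [x Xx <-] <-]|_ [_ [x Xx <-] <-]].
  by exists (dotmul u x); [exists x|rewrite dotmulZr].
by exists (a *: x); [exists x|rewrite dotmulZr].
Qed.

Lemma measurable_cosum p A1 A2 : measurable (cosum C p A1 A2).
Proof.
apply: measurableD; first exact: cone_measurable.
apply: closed_measurable_row; apply: closedI; first exact: cone_closed.
apply: closed_bigI => u _; rewrite /lower_halfspace.
apply: (@preimage_closed _ _ (fun x => dotmul x u) [set y | y <= _]); last exact: closed_le.
by move=> x _; exact: continuous_dotmull.
Qed.

(* If the p-th powers of the radial functions sum to at most 1 at x, then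
   h_i(u) <= r_i(x) |x.u| for all u yields x.u <= -(h_1^p + h_2^p)^(1/p). *)
Lemma cosum_sub_radial p A1 A2 : 0 < p ->
  pseudo_cone C (C `\` A1) -> pseudo_cone C (C `\` A2) ->
  cosum C p A1 A2 `<=`
    [set x | 1 < radial (C `\` A1) x `^ p + radial (C `\` A2) x `^ p] `|`
    ((C `\` ray_meets (C `\` A1)) `|` (C `\` ray_meets (C `\` A2))).
Proof.
move=> p0 pX1 pX2 x [Cx nB].
(* On a ray missing a complement the default [radial] value 0 does not bound the support function;
   such x go to the extra cones. *)
have [E1|nE1] := pselect (ray_meets (C `\` A1) x); last by right; left.
have [E2|nE2] := pselect (ray_meets (C `\` A2) x); last by right; right.
left; rewrite /= ltNge; apply/negP => r1; apply: nB; split => // u [_ iu].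
have Pu : polar C u := interior_subset iu.
rewrite /lower_halfspace/= -lerN2 opprK.
have d0 : 0 <= - dotmul x u by rewrite oppr_ge0 dotmulC; exact: Pu.
have hp A : pseudo_cone C (C `\` A) -> ray_meets (C `\` A) x ->
    cosupport C A u `^ p <= radial (C `\` A) x `^ p * (- dotmul x u) `^ p.
  move=> pX Ex; have r0 := radial_ge0 coneC pX x.
  rewrite -powRM// ge0_ler_powR ?nnegrE ?mulr_ge0 ?(ltW p0)//.
    exact: cosupport_ge0.
  exact: cosupport_radial.
rewrite -[leRHS]powRr1// -(@divff _ p) ?gt_eqF// powRrM.
apply: ge0_ler_powR; rewrite ?nnegrE ?invr_ge0 ?(ltW p0) ?powR_ge0 ?addr_ge0 ?powR_ge0//.
apply: (le_trans (lerD (hp _ pX1 E1) (hp _ pX2 E2))).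
by rewrite -mulrDl ler_piMl ?powR_ge0.
Qed.

(** The support functions of a A and A at u are a h(u) and h(u), so the halfspace at u has bound -b
    h(u) with b = (a^p + 1)^(1/p). For x in A some u in Omega has x.u > -h(u), and b x violates that
    halfspace. *)
Lemma dilate_sub_cosum p A a : 0 < p -> 0 < a -> A `<=` C ->
  pseudo_cone C (C `\` A) -> convex_set (C `\` A) ->
  dilate ((a `^ p + 1) `^ p^-1) A `<=` cosum C p (dilate a A) A.
Proof.
move=> p0 a0 AC pX convX _ [x Ax <-].
set b := _ `^ p^-1; have b0 : 0 < b by rewrite powR_gt0// addr_gt0// powR_gt0.
split; first by apply: coneZ => //; [exact: ltW|exact: AC].
move=> [_ hB].
have [u Ou ux] : exists2 u, Omega C u & sup [set dotmul u y | y in C `\` A] < dotmul x u.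
  by apply: (Omega_separation n0 coneC C0 pX convX); case.
have Pu : polar C u by apply: interior_subset; case: Ou.
have := hB _ Ou; rewrite /lower_halfspace/= cosupport_dilate//.
have h0 := cosupport_ge0 pX Pu.
rewrite (powRM _ (ltW a0) h0) -[X in _ + X]mul1r -mulrDl powRM ?powR_ge0//; last first.
  by rewrite addr_ge0// powR_ge0.
rewrite -/b -powRrM divff ?gt_eqF// powRr1// dotmulZl -mulrN ler_pM2l//.
by rewrite /cosupport opprK leNgt ux.
Qed.

End cosum.

(** * The volume inequality and its equality case *)

Section brunn_minkowski.
Context {R : realType} {n : nat}.
Variables (C A1 A2 : set 'rV[R]_n) (p : R).
Hypotheses (n0 : (0 < n)%N).
Hypotheses (coneC : pointed_closed_convex_cone C) (C0 : interior C !=set0).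
Hypotheses (coA1 : coconvex C A1) (A1_ne : A1 !=set0).
Hypotheses (coA2 : coconvex C A2) (A2_ne : A2 !=set0).
Hypothesis p01 : 0 < p < 1.
Implicit Types (x : 'rV[R]_n).

Let p0 : 0 < p. Proof. by case/andP: p01. Qed.
Let n_gt0 : 0 < n%:R :> R. Proof. by rewrite ltr0n. Qed.

Let m : R := n%:R / p.

Let m1 : 1 < m.
Proof.
rewrite ltr_pdivlMr// mul1r; apply: (@lt_le_trans _ _ 1); first by case/andP: p01.
by rewrite ler1n.
Qed.

Let mV : m^-1 = p / n%:R. Proof. by rewrite invf_div. Qed.

Let coconvexK A : coconvex C A -> C `\` (C `\` A) = A.
Proof. by move=> [AC _ _ _]; rewrite setDD setIidr. Qed.

(* 0-homogeneous, hence suited to [volume_polar]. *)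
Definition radial_powR (X : set 'rV[R]_n) x : R := `|x| `^ p * radial X x `^ p.

(** As p m = n, the factor |x|^n cancels away from the origin, where both sides vanish. This puts a
    set {s > 1} in the form that [volume_polar] handles. *)
Lemma norm_lt_powR x (s : R) : 0 <= s ->
  (`|x| ^+ n < (`|x| `^ p * s) `^ m) = (x != 0) && (1 < s).
Proof.
move=> s0; rewrite powRM ?powR_ge0// -powRrM.
rewrite (_ : p * m = n%:R) ?powR_mulrn//; last by rewrite /m mulrC divfK ?gt_eqF.
have [->|x0] /= := eqVneq x 0.
  by rewrite normr0 expr0n (gtn_eqF n0) mul0r ltxx.
rewrite -[ltLHS]mulr1 ltr_pM2l ?exprn_gt0 ?normr_gt0//.
by rewrite ltr1_powR// divr_gt0.
Qed.

Section radial_powR.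
Variable X : set 'rV[R]_n.
Hypothesis pX : pseudo_cone C X.

Lemma radial_powR_ge0 x : 0 <= radial_powR X x.
Proof. by rewrite mulr_ge0 ?powR_ge0. Qed.

Lemma measurable_radial_powR : measurable_fun setT (radial_powR X).
Proof.
apply: measurable_funM; apply: (measurableT_comp (measurable_powR p)).
  exact: measurable_norm_row.
exact: (measurable_radial coneC pX).
Qed.

Lemma radial_powR_homog c x : 0 < c -> radial_powR X (c *: x) = radial_powR X x.
Proof.
move=> c0; rewrite /radial_powR (radialZ coneC pX _ c0) normrZ gtr0_norm//.
have r0 := radial_ge0 coneC pX x.
rewrite -!powRM// ?mulr_ge0 ?invr_ge0 ?(ltW c0)//.
by rewrite mulrACA divff ?mul1r// gt_eqF.
Qed.

Lemma radial0 : radial X 0 = 0.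
Proof.
by apply: radial_out => -[t _]; rewrite scaler0; case: pX => _ _ _ + _; exact.
Qed.

Lemma volume_radial_powR : (volume (C `\` X) < +oo)%E ->
  volume (C `\` X) =
  (\int[@volume R n]_(x in [set x | (`|x| < 1)%R]) (radial_powR X x `^ m)%:E)%E.
Proof.
move=> Xfin; rewrite (volume_cone_setD n0 coneC pX Xfin).
rewrite -(@volume_polar _ _ n0 (fun x => radial_powR X x `^ m)).
- congr volume; apply/seteqP; split => x /=;
    rewrite norm_lt_powR ?powR_ge0// ltr1_powR ?(radial_ge0 coneC pX)//.
    by move=> r1; rewrite r1 andbT; apply: contraTneq r1 => ->; rewrite radial0 -leNgt.
  by case/andP.
- by apply: (measurableT_comp (measurable_powR m)); exact: measurable_radial_powR.
- by move=> x; exact: powR_ge0.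
- by move=> c x c0; rewrite radial_powR_homog.
Qed.

End radial_powR.

Let X1 := C `\` A1.
Let X2 := C `\` A2.
Let pX1 : pseudo_cone C X1. Proof. exact: coconvex_pseudo_cone. Qed.
Let pX2 : pseudo_cone C X2. Proof. exact: coconvex_pseudo_cone. Qed.
Let A1fin : (volume A1 < +oo)%E. Proof. by case: coA1. Qed.
Let A2fin : (volume A2 < +oo)%E. Proof. by case: coA2. Qed.

(** The two cones of missed rays in [cosum_sub_radial] are null; what remains is the region that
    [volume_polar] measures. *)
Lemma volume_cosum_le :
  (volume (cosum C p A1 A2) <=
  \int[@volume R n]_(x in [set x | (`|x| < 1)%R])
    ((radial_powR X1 x + radial_powR X2 x) `^ m)%:E)%E.
Proof.
have mr1 := measurable_radial_powR pX1; have mr2 := measurable_radial_powR pX2.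
rewrite -(@volume_polar _ _ n0 (fun x => (radial_powR X1 x + radial_powR X2 x) `^ m)).
- set K := [set x | _]; set S1 := C `\` ray_meets X1; set S2 := C `\` ray_meets X2.
  have mK : measurable K.
    apply: measurable_set_ltr; first by apply: measurable_funX; exact: measurable_norm_row.
    by apply: (measurableT_comp (measurable_powR m)); exact: measurable_funD.
  have mS1 : measurable S1.
    apply: measurableD; first exact: cone_measurable.
    exact: (measurable_ray_meets coneC pX1).
  have mS2 : measurable S2.
    apply: measurableD; first exact: cone_measurable.
    exact: (measurable_ray_meets coneC pX2).
  have S10 : volume S1 = 0%E.
    by apply: (volume_ray_misses n0 coneC pX1); rewrite coconvexK.
  have S20 : volume S2 = 0%E.
    by apply: (volume_ray_misses n0 coneC pX2); rewrite coconvexK.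
  rewrite -(@measureU0 _ _ _ (@volume R n) K (S1 `|` S2))//; first last.
  + by apply: eq_trans (measureU0 mS1 mS2 S20) _.
  + exact: measurableU.
  apply: le_measure; rewrite ?inE.
  + exact: measurable_cosum.
  + by apply: measurableU => //; exact: measurableU.
  move=> x /(cosum_sub_radial coneC p0 pX1 pX2)[/= r12|S12]; last by right.
  left; rewrite /K/= /radial_powR -mulrDr norm_lt_powR ?addr_ge0 ?powR_ge0//.
  (* The origin is excluded because both radial functions are 0 there. *)
  rewrite r12 andbT; apply: contraTneq r12 => ->.
  by rewrite radial0// radial0// powR0 ?gt_eqF// addr0 -leNgt ler01.
- apply: (measurableT_comp (measurable_powR m)); exact: measurable_funD.
- by move=> x; exact: powR_ge0.
- by move=> c x c0; rewrite !radial_powR_homog.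
Qed.

Let volume_fin A : coconvex C A -> volume A \is a fin_num.
Proof. by move=> [_ Afin _ _]; rewrite ge0_fin_numE. Qed.

Let volume_gt0 A : coconvex C A -> A !=set0 -> 0 < fine (volume A).
Proof.
move=> coA A_ne; rewrite fine_gt0//; have [_ -> _ _] := coA.
rewrite andbT -(coconvexK coA).
by apply: (volume_cone_setD_gt0 coneC C0); exact: coconvex_pseudo_cone.
Qed.

(** With [b], the L^m norms over the unit ball of the two functions [radial_powR]. *)
Let a := fine (volume A1) `^ m^-1.
Let b := fine (volume A2) `^ m^-1.
Let a0 : 0 < a. Proof. by rewrite powR_gt0// volume_gt0. Qed.
Let b0 : 0 < b. Proof. by rewrite powR_gt0// volume_gt0. Qed.
Let m0 : 0 < m. Proof. exact: lt_trans ltr01 m1. Qed.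

Let root_powR v : 0 <= v -> (v `^ m^-1) `^ m = v.
Proof. by move=> v0; rewrite -powRrM mulVf ?gt_eqF// powRr1. Qed.

Lemma coconvex_volume_root A : coconvex C A ->
  (volume A `^ (p / n%:R))%E =
  (fine (volume A) `^ m^-1)%:E.
Proof. by move=> coA; rewrite mV -poweR_EFin fineK// volume_fin. Qed.

Let minkowski_radial :
  let I := (\int[@volume R n]_(x in [set x | (`|x| < 1)%R])
    ((radial_powR X1 x + radial_powR X2 x) `^ m)%:E)%E in
  (I <= ((a + b) `^ m)%:E)%E /\
  (I = ((a + b) `^ m)%:E ->
   volume ([set x | `|x| < 1] `&`
     [set x | radial_powR X1 x * b != radial_powR X2 x * a]) = 0%E).
Proof.
have integral_radial A : coconvex C A -> A !=set0 ->
    (\int[@volume R n]_(x in [set x | (`|x| < 1)%R])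
      (radial_powR (C `\` A) x `^ m)%:E = ((fine (volume A) `^ m^-1) `^ m)%:E)%E.
  move=> coA A_ne; rewrite -volume_radial_powR//.
  - by rewrite root_powR ?fine_ge0// fineK ?volume_fin// coconvexK.
  - exact: coconvex_pseudo_cone.
  - by rewrite coconvexK//; case: coA.
apply: minkowski_powR => //.
- by apply: measurable_set_ltr => //; exact: measurable_norm_row.
- exact: measurable_radial_powR.
- exact: measurable_radial_powR.
- exact: radial_powR_ge0.
- exact: radial_powR_ge0.
- exact: integral_radial.
- exact: integral_radial.
Qed.

Let cosum_fin : volume (cosum C p A1 A2) \is a fin_num.
Proof.
rewrite ge0_fin_numE//; apply: (le_lt_trans volume_cosum_le).
by apply: (le_lt_trans minkowski_radial.1); rewrite ltry.
Qed.

Lemma cosum_root_le : fine (volume (cosum C p A1 A2)) `^ m^-1 <= a + b.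
Proof.
rewrite -[leRHS]powRr1 ?addr_ge0 ?(ltW a0) ?(ltW b0)//.
rewrite -(@divff _ m) ?gt_eqF// powRrM.
rewrite ge0_ler_powR ?invr_ge0 ?(ltW m0)// ?nnegrE ?powR_ge0 ?fine_ge0//.
rewrite -lee_fin fineK//; apply: (le_trans volume_cosum_le).
exact: minkowski_radial.1.
Qed.

(** Equality collapses the chain volume <= integral <= (a + b)^m, so the equality case of
    Minkowski's inequality applies to the integral. *)
Lemma cosum_root_eq : fine (volume (cosum C p A1 A2)) `^ m^-1 = a + b ->
  exists2 c : R, 0 < c & A1 = dilate c A2.
Proof.
move=> veq.
have /minkowski_radial.2 ae : (\int[@volume R n]_(x in [set x | (`|x| < 1)%R])
    ((radial_powR X1 x + radial_powR X2 x) `^ m)%:E = ((a + b) `^ m)%:E)%E.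
  apply/eqP; rewrite eq_le minkowski_radial.1/= -veq root_powR ?fine_ge0//.
  by rewrite fineK//; exact: volume_cosum_le.
(* Solves r_1^p b = r_2^p a for r_1 = c r_2. *)
pose c := (a / b) `^ p^-1.
have c0 : 0 < c by rewrite powR_gt0// divr_gt0.
exists c => //.
pose D := [set x | radial X1 x != c * radial X2 x].
have mr1 := measurable_radial coneC pX1; have mr2 := measurable_radial coneC pX2.
have mD : measurable D.
  by apply: measurable_set_neqr => //; exact: measurable_funM.
have hD : homog0 D.
  move=> t x t0; rewrite /D/= (radialZ coneC pX1 _ t0) (radialZ coneC pX2 _ t0).
  by rewrite mulrCA (inj_eq (mulfI _))// invr_eq0 gt_eqF.
have D0 : volume D = 0%E.
  apply: homog0_null => //.
  apply: (subset_measure0 _ _ _ ae).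
  - apply: measurableI => //; apply: measurable_set_ltr => //; exact: measurable_norm_row.
  - apply: measurableI; first by apply: measurable_set_ltr => //; exact: measurable_norm_row.
    have mR1 := measurable_radial_powR pX1; have mR2 := measurable_radial_powR pX2.
    by apply: measurable_set_neqr; exact: measurable_funM.
  move=> x [Qx Dx]; split => //=; apply: contra_neq Dx => Gx.
  have [->|x0] := eqVneq x 0; first by rewrite !radial0// mulr0.
  have r10 := radial_ge0 coneC pX1 x; have r20 := radial_ge0 coneC pX2 x.
  apply: (powR_injective p0); rewrite ?nnegrE ?mulr_ge0 ?(ltW c0)//.
  rewrite powRM ?(ltW c0)// -powRrM mulVf ?gt_eqF// powRr1; last first.
    by rewrite divr_ge0// ltW.
  have xp : `|x| `^ p != 0 by rewrite gt_eqF// powR_gt0// normr_gt0.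
  apply: (mulfI xp); apply: (mulIf (lt0r_neq0 b0)).
  rewrite [LHS]Gx /radial_powR -!mulrA; congr (_ * _).
  by field; rewrite gt_eqF.
have X12 : X1 = dilate c X2.
  apply: (radial_ae_inj coneC C0 pX1 (pseudo_cone_dilate c0 coneC pX2)).
  rewrite -[RHS]D0; congr volume; apply/seteqP.
  by split => x; rewrite /D/= (radial_dilate _ c0 coneC pX2).
rewrite -(coconvexK coA1) -/X1 X12 dilate_setD// [C `\` X2]coconvexK//.
Qed.

(** With k^p = c^p + 1, the dilate k A2 inside the p-co-sum has V(k A2)^(p/n) = k^p b = c^p b + b =
    a + b. *)
Lemma cosum_root_dilate c : 0 < c -> A1 = dilate c A2 ->
  a + b <= fine (volume (cosum C p A1 A2)) `^ m^-1.
Proof.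
move=> c0 A12; pose k := (c `^ p + 1) `^ p^-1.
have k0 : 0 < k by rewrite powR_gt0// addr_gt0// powR_gt0.
have mA2 : measurable A2.
  rewrite -(coconvexK coA2); apply: measurableD; first exact: cone_measurable.
  exact: (measurable_pseudo_cone pX2).
have v2 := ltW (volume_gt0 coA2 A2_ne).
have rootM t : 0 < t -> (t ^+ n * fine (volume A2)) `^ m^-1 = t `^ p * b.
  move=> t0; rewrite powRM ?exprn_ge0 ?(ltW t0)// -powR_mulrn ?(ltW t0)//.
  rewrite -powRrM; congr (_ `^ _ * _).
  by rewrite mV mulrCA divff ?mulr1// gt_eqF.
have aE : a = c `^ p * b.
  rewrite /a A12 volume_dilate// -(fineK (volume_fin coA2)) -EFinM /=.
  exact: rootM.
rewrite aE -[X in _ + X]mul1r -mulrDl.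
have -> : c `^ p + 1 = k `^ p.
  by rewrite -powRrM mulVf ?gt_eqF// powRr1// addr_ge0// powR_ge0.
rewrite -rootM//.
apply: ge0_ler_powR; rewrite ?invr_ge0 ?(ltW m0)// ?nnegrE ?fine_ge0//.
  by rewrite mulr_ge0// exprn_ge0// ltW.
rewrite -lee_fin fineK// EFinM fineK ?volume_fin// -volume_dilate//.
apply: le_measure; rewrite ?inE.
- exact: measurable_dilate.
- exact: measurable_cosum.
- rewrite A12; apply: dilate_sub_cosum => //; first by case: coA2.
  by case: coA2.
Qed.

Lemma cosum_volume_root :
  (volume (cosum C p A1 A2) `^ (p / n%:R))%E =
  (fine (volume (cosum C p A1 A2)) `^ m^-1)%:E.
Proof. by rewrite mV -poweR_EFin fineK. Qed.

End brunn_minkowski.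

Theorem theorem3p1 (R : realType) (n : nat) (C A1 A2 : set 'rV[R]_n) (p : R) :
  (0 < n)%N ->
  pointed_closed_convex_cone C -> interior C !=set0 ->
  coconvex C A1 -> A1 !=set0 ->
  coconvex C A2 -> A2 !=set0 ->
  0 < p < 1 ->
  (volume (cosum C p A1 A2) `^ (p / n%:R)
     <= volume A1 `^ (p / n%:R) + volume A2 `^ (p / n%:R))%E
  /\
  ((volume (cosum C p A1 A2) `^ (p / n%:R)
     = volume A1 `^ (p / n%:R) + volume A2 `^ (p / n%:R))%E
   <-> exists2 a : R, 0 < a & A1 = dilate a A2).
Proof.
move=> n0 coneC C0 coA1 A1_ne coA2 A2_ne p01.
rewrite (cosum_volume_root n0 coneC C0 coA1 A1_ne coA2 A2_ne p01).
rewrite (coconvex_volume_root p coA1) (coconvex_volume_root p coA2).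
rewrite -EFinD lee_fin.
have le := cosum_root_le n0 coneC C0 coA1 A1_ne coA2 A2_ne p01.
split; first exact: le.
split=> [[]|[a a0 A12]]; first exact: cosum_root_eq.
congr EFin; apply/eqP; rewrite eq_le le/=.
exact: (cosum_root_dilate n0 coneC C0 coA1 A1_ne coA2 A2_ne p01 a0 A12).
Qed.
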